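(* Let $r,k\in\mathbb Z$, $0\le k\le r-1$. Suppose that $U\in Y_r$ solves $Q^r_k\text{-}\mathbf{VTD}^r_k\big(\mathcal I^{r+1}_{k+2}f\big)$. Determine $\widetilde U\in Y_{r+1}$ from $U$ by the residual-based postprocessing or by the jump-based postprocessing (both defined in the context). Then $\widetilde U$ solves $Q^{r+1}_{k+2}\text{-}\mathbf{VTD}^{r+1}_{k+2}\big(f\big)$.
   Context: Problem: $M u'(t)=f(t)-Au(t)$, $u(t_0)=u_0\in\mathbb R^d$, on $I=(t_0,t_0+T]$, $T>0$, with time-independent $M,A\in\mathbb R^{d\times d}$, $M$ regular, and $f:\overline I\to\mathbb R^d$ sufficiently smooth (all derivatives of $f$ that occur exist and are continuous). The values $u^{(j)}(t_0)$ are defined recursively by $u^{(0)}(t_0)=u_0$ and $M u^{(j)}(t_0)=f^{(j-1)}(t_0)-Au^{(j-1)}(t_0)$, $j\ge1$. Notation: mesh $t_0<t_1<\dots<t_N=t_0+T$, $I_n=(t_{n-1},t_n]$, $\tau_n=t_n-t_{n-1}$. $(\cdot,\cdot)$ is the Euclidean inner product on $\mathbb R^d$. $P_s(J,\mathbb R^q)$ is the space of $\mathbb R^q$-valued polynomials on $J$ of degree $\le s$. $Y_s$ is the space of functions $\varphi\in L^2(I,\mathbb R^d)$ with $\varphi|_{I_n}\in P_s(I_n,\mathbb R^d)$ for all $n=1,\dots,N$. $v(t_n^\pm)$ are one-sided limits (derivatives of piecewise smooth functions are taken interval-wise), $[v]_n=v(t_n^+)-v(t_n^-)$. $\delta_{i,j}$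 is the Kronecker delta. Note $\lfloor (k-1)/2\rfloor=-1$ for $k=0$. Interpolation and quadrature: for integers $0\le m\le s$ let $\widehat{\mathcal I}^s_m:C^{\lfloor m/2\rfloor}([-1,1])\to P_s([-1,1])$ be the Hermite interpolation operator preserving derivatives of orders $0,\dots,\lfloor\frac{m-1}{2}\rfloor$ at $-1$ (none if $m=0$), derivatives of orders $0,\dots,\lfloor\frac m2\rfloor$ at $+1$, and the function values at the zeros $\hat t_1,\dots,\hat t_{s-m}\in(-1,1)$ of the $(s-m)$th Jacobi polynomial with respect to the weight $(1+\hat t)^{\lfloor\frac{m-1}{2}\rfloor+1}(1-\hat t)^{\lfloor\frac m2\rfloor+1}$. Let $\widehat Q^s_m[\hat g]=\int_{-1}^1\widehat{\mathcal I}^s_m\hat g\,\mathrm d\hat t$. $\mathcal I^s_m$ (applied componentwise on each $I_n$) and $Q^s_m$ denote their affine transformations to $I_n$ (so $Q^s_m[\varphi]=\int_{I_n}\mathcal I^s_m\varphi\,\mathrm dt$). The $s+1$ quadrature points of $Q^s_m$ on $I_n$, counted with multiplicity, are $t_{n-1}$ with multiplicity $\lfloor\frac{m-1}{2}\rfloor+1$, $t_n$ with multiplicity $\lfloor\frac m2\rfloor+1$, and the simple interior points $\frac12(t_{n-1}+t_n+\tau_n\hat t_i)$, $i=1,\dots,s-m$; ''vanishing in all quadrature points'' means having zeros of (at least) these multiplicities. Method: for a quadrature rule $Q$ on $I_n$, integers $0\le m\le s$ and an interval-wise sufficiently smooth function $g$, a function $V\in Y_s$ with $V(t_0^-)=u_0$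 solves $Q\text{-}\mathbf{VTD}^s_m(g)$ if for every $n=1,\dots,N$: (1) if $m\ge1$: $V(t_{n-1}^+)=V(t_{n-1}^-)$; (2) if $m\ge2$: $M V^{(i+1)}(t_n^-)=g^{(i)}(t_n^-)-AV^{(i)}(t_n^-)$ for $i=0,\dots,\lfloor\frac m2\rfloor-1$; (3) if $m\ge3$: $M V^{(i+1)}(t_{n-1}^+)=g^{(i)}(t_{n-1}^+)-AV^{(i)}(t_{n-1}^+)$ for $i=0,\dots,\lfloor\frac{m-1}2\rfloor-1$; (4) $Q\big[(MV',\varphi)\big]+\delta_{0,m}\big(M[V]_{n-1},\varphi(t_{n-1}^+)\big)=Q\big[(g-AV,\varphi)\big]$ for all $\varphi\in P_{s-m}(I_n,\mathbb R^d)$. Residual-based postprocessing of $U\in Y_r$: $\widetilde U|_{I_n}=U|_{I_n}+a_n\vartheta_n$ for $n=1,\dots,N$ and $\widetilde U(t_0^-)=U(t_0^-)$, where $\vartheta_n\in P_{r+1}(I_n,\mathbb R)$ vanishes in all $r+1$ quadrature points of $Q^r_k$ and $\vartheta_n^{(\lfloor k/2\rfloor+1)}(t_n^-)=1$, and $$a_n=M^{-1}\left(f^{(\lfloor k/2\rfloor)}(t_n^-)-AU^{(\lfloor k/2\rfloor)}(t_n^-)-MU^{(\lfloor k/2\rfloor+1)}(t_n^-)\right).$$ Jump-based postprocessing of $U\in Y_r$: $\widetilde U|_{I_n}=U|_{I_n}-\tilde a_n\tilde\vartheta_n$ for $n=1,\dots,N$ and $\widetilde U(t_0^-)=U(t_0^-)$,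 where $\tilde\vartheta_n\in P_{r+1}(I_n,\mathbb R)$ vanishes in all $r+1$ quadrature points of $Q^r_k$ and $\tilde\vartheta_n^{(\lfloor\frac{k-1}2\rfloor+1)}(t_{n-1}^+)=1$, and, with $q=\lfloor\frac{k-1}2\rfloor+1$, $\tilde a_1=U^{(q)}(t_0^+)-u^{(q)}(t_0)$ and $\tilde a_n=U^{(q)}(t_{n-1}^+)-\widetilde U^{(q)}(t_{n-1}^-)$ for $n>1$. *)

(* Defs.v *)
From HB Require Import structures.
From mathcomp Require Import all_boot all_order all_algebra.
From mathcomp Require Import all_classical all_reals all_analysis.

Set Implicit Arguments.
Unset Strict Implicit.
Unset Printing Implicit Defensive.

Import Order.TTheory GRing.Theory Num.Theory.
Import numFieldNormedType.Exports.

Local Open Scope classical_set_scope.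
Local Open Scope ring_scope.

(* Arithmetic with floors, for a natural number m:
     floor(m / 2)           is m./2,
     floor((m - 1) / 2) + 1 is uphalf m   (0 for m = 0),
     floor((m - 1) / 2)     is m.-1./2    for m >= 1. *)

Section OneSidedDerivatives.
Context {R : realType}.

(* [dright g j a] is g^(j)(a^+) and [dleft g j a] is g^(j)(a^-).  The derivative
   is taken off the point a only, so that for an interval-wise smooth function
   no smoothness across a mesh point is involved. *)
Definition dright (g : R -> R) (j : nat) (a : R) : R :=
  lim (derive1n j g x @[x --> a^'+]).

Definition dleft (g : R -> R) (j : nat) (a : R) : R :=
  lim (derive1n j g x @[x --> a^'-]).

(* g is in C^K([a, b]): only the values of g on [a, b] matter; the derivatives
   of order <= K exist and are continuous inside and extend continuously to the
   endpoints. *)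
Definition smooth_on (K : nat) (a b : R) (g : R -> R) : Prop :=
  [/\ {within `[a, b], continuous g},
      forall j x, (j < K)%N -> x \in `]a, b[ -> derivable (derive1n j g) x 1,
      forall j x, (j <= K)%N -> x \in `]a, b[ ->
        {for x, continuous (derive1n j g)}
    & forall j, (j <= K)%N ->
        cvg (derive1n j g x @[x --> a^'+]) /\
        cvg (derive1n j g x @[x --> b^'-])].

Context {d : nat}.
Implicit Type V : R -> 'cV[R]_d.

Definition vdright V (j : nat) (a : R) : 'cV[R]_d :=
  \col_i dright (fun x => V x i 0) j a.

Definition vdleft V (j : nat) (a : R) : 'cV[R]_d :=
  \col_i dleft (fun x => V x i 0) j a.

Definition vderive V (x : R) : 'cV[R]_d :=
  \col_i derive1n 1 (fun y => V y i 0) x.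

Definition vsmooth_on (K : nat) (a b : R) V : Prop :=
  forall i, smooth_on K a b (fun x => V x i 0).

Definition dot (x y : 'cV[R]_d) : R := \sum_i x i 0 * y i 0.

Definition vpoly_deg (s : nat) (p : 'cV[{poly R}]_d) : Prop :=
  forall i, (size (p i 0%R) <= s.+1)%N.

Definition vhorner (p : 'cV[{poly R}]_d) (x : R) : 'cV[R]_d :=
  \col_i (p i 0).[x].

End OneSidedDerivatives.

Section InterpolationQuadrature.
Context {R : realType}.

(* The monic Jacobi polynomial of degree n for the weight
   (1 + x)^a (1 - x)^b, i.e. the monic orthogonal polynomial on [-1, 1]. *)
Definition is_jacobi (a b n : nat) (P : {poly R}) : Prop :=
  [/\ P \is monic, size P = n.+1
    & forall q : {poly R}, (size q <= n)%N ->
        \int[lebesgue_measure]_(x in `[-1, 1])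
          ((1 + x) ^+ a * (1 - x) ^+ b * P.[x] * q.[x]) = 0].

Definition jacobi (a b n : nat) : {poly R} :=
  xget 0 [set P | is_jacobi a b n P].

Definition ref_node_poly (s m : nat) : {poly R} :=
  jacobi (uphalf m) m./2.+1 (s - m).

Definition is_ref_interp (s m : nat) (g : R -> R) (p : {poly R}) : Prop :=
  [/\ (size p <= s.+1)%N,
      forall j, (j < uphalf m)%N -> (p^`(j)).[-1] = dright g j (-1),
      forall j, (j <= m./2)%N -> (p^`(j)).[1] = dleft g j 1
    & forall x, root (ref_node_poly s m) x -> p.[x] = g x].

Definition ref_interp (s m : nat) (g : R -> R) : {poly R} :=
  xget 0 [set p | is_ref_interp s m g p].

Definition from_ref (a b x : R) : R := (a + b + (b - a) * x) / 2.
Definition to_ref (a b x : R) : R := (2 * x - (a + b)) / (b - a).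

Definition interp (s m : nat) (a b : R) (g : R -> R) (x : R) : R :=
  (ref_interp s m (g \o from_ref a b)).[to_ref a b x].

Definition quad (s m : nat) (a b : R) (g : R -> R) : R :=
  \int[lebesgue_measure]_(x in `[a, b]) interp s m a b g x.

(* At most one summand is present: the one with x in ]t_n, t_{n+1}]. *)
Definition mesh_interp (d : nat) (s m : nat) (t : nat -> R) (N : nat)
    (f : R -> 'cV[R]_d) (x : R) : 'cV[R]_d :=
  \sum_(n < N | t n < x <= t n.+1)
    \col_i interp s m (t n) (t n.+1) (fun y => f y i 0) x.

(* theta has zeros, with (at least) their multiplicities, in all quadrature
   points of quad s m a b. *)
Definition vanishes_at_nodes (s m : nat) (a b : R) (theta : {poly R}) : Prop :=
  [/\ (('X - a%:P) ^+ uphalf m %| theta)%R,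
      (('X - b%:P) ^+ m./2.+1 %| theta)%R
    & forall x, root (ref_node_poly s m) x -> root theta (from_ref a b x)].

End InterpolationQuadrature.

(* Mesh intervals are numbered from 0: the n-th one is ]t n, t n.+1], n < N.
   A function in Y_s together with its value at t_0^- is given by a function
   V : R -> R^d: V(t_0^-) is V (t 0), which is free since t 0 is not in
   I = ]t 0, t N]; values of V outside [t 0, t N] are irrelevant. *)
Section Method.
Context {R : realType} {d : nat}.
Variables (M A : 'M[R]_d) (u0 : 'cV[R]_d) (t : nat -> R) (N : nat).
Implicit Types (V U Ut f g : R -> 'cV[R]_d).

Definition in_Y (s : nat) V : Prop :=
  forall n, (n < N)%N -> exists2 p : 'cV[{poly R}]_d, vpoly_deg s p &
    forall x, x \in `]t n, t n.+1] -> V x = vhorner p x.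

(* V(t_n^-) *)
Definition left_value V (n : nat) : 'cV[R]_d :=
  if n is 0 then V (t 0) else vdleft V 0 (t n).

Definition jump V (n : nat) : 'cV[R]_d := vdright V 0 (t n) - left_value V n.

(* V solves Q-VTD^s_m(g); Q a b is the quadrature rule on the interval ]a, b]. *)
Definition solves_VTD (Q : R -> R -> (R -> R) -> R) (s m : nat) g V : Prop :=
  [/\ in_Y s V,
      left_value V 0 = u0
    & forall n, (n < N)%N ->
      [/\ (1 <= m)%N -> vdright V 0 (t n) = left_value V n,
          forall i, (i < m./2)%N ->
            M *m vdleft V i.+1 (t n.+1) =
            vdleft g i (t n.+1) - A *m vdleft V i (t n.+1),
          forall i, (i < m.-1./2)%N ->
            M *m vdright V i.+1 (t n) = vdright g i (t n) - A *m vdright V i (t n)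
        & forall p : 'cV[{poly R}]_d, vpoly_deg (s - m) p ->
            Q (t n) (t n.+1) (fun x => dot (M *m vderive V x) (vhorner p x))
            + (m == 0%N)%:R * dot (M *m jump V n) (vhorner p (t n))
            = Q (t n) (t n.+1) (fun x => dot (g x - A *m V x) (vhorner p x))]].

(* u^(j)(t_0) *)
Fixpoint u_init f (j : nat) : 'cV[R]_d :=
  if j is i.+1 then invmx M *m (vdright f i (t 0) - A *m u_init f i) else u0.

Definition is_theta_res (r k : nat) (a b : R) (theta : {poly R}) : Prop :=
  [/\ (size theta <= r.+2)%N, vanishes_at_nodes r k a b theta
    & (theta^`(k./2.+1)).[b] = 1].

Definition theta_res (r k : nat) (a b : R) : {poly R} :=
  xget 0 [set theta | is_theta_res r k a b theta].

Definition coef_res (k : nat) f U (n : nat) : 'cV[R]_d :=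
  invmx M *m (vdleft f k./2 (t n.+1) - A *m vdleft U k./2 (t n.+1)
              - M *m vdleft U k./2.+1 (t n.+1)).

Definition residual_post (r k : nat) f U Ut : Prop :=
  left_value Ut 0 = left_value U 0 /\
  forall n, (n < N)%N -> forall x, x \in `]t n, t n.+1] ->
    Ut x = U x + (theta_res r k (t n) (t n.+1)).[x] *: coef_res k f U n.

Definition is_theta_jump (r k : nat) (a b : R) (theta : {poly R}) : Prop :=
  [/\ (size theta <= r.+2)%N, vanishes_at_nodes r k a b theta
    & (theta^`(uphalf k)).[a] = 1].

Definition theta_jump (r k : nat) (a b : R) : {poly R} :=
  xget 0 [set theta | is_theta_jump r k a b theta].

Definition coef_jump (k : nat) f U Ut (n : nat) : 'cV[R]_d :=
  vdright U (uphalf k) (t n) -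
  (if n is 0 then u_init f (uphalf k) else vdleft Ut (uphalf k) (t n)).

Definition jump_post (r k : nat) f U Ut : Prop :=
  left_value Ut 0 = left_value U 0 /\
  forall n, (n < N)%N -> forall x, x \in `]t n, t n.+1] ->
    Ut x = U x - (theta_jump r k (t n) (t n.+1)).[x] *: coef_jump k f U Ut n.

End Method.

(* Main.v *)
Require Import Defs.
From HB Require Import structures.
From mathcomp Require Import all_boot all_order all_algebra.
From mathcomp Require Import all_classical all_reals all_analysis.
From mathcomp Require Import ring lra zify.
Import Order.TTheory GRing.Theory Num.Theory.
Import numFieldNormedType.Exports.
Local Open Scope classical_set_scope.
Local Open Scope ring_scope.

(** On one mesh interval [[a, b]] everything is polynomial: the solution [U], its
    correction [Ut = U + th c] and the interpolant [F] of [f], which has the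
    same node data as [f]. Let [rho = M U' + A U - F] and let
    [rt = M Ut' + A Ut - F = rho + (M c) th' + (A c) th]. Put [q = uphalf k]
    and [l = k./2 + 1], the multiplicities of the nodes [a] and [b], and let
    [om = (X - a)^q (X - b)^l w] be the nodal polynomial of the rule [Q] for
    [U], where [w] is the Jacobi polynomial of degree [r - k] on [[a, b]].

    The equations for [U] say that [rho] vanishes to order [q - 1] at [a] and
    [l - 1] at [b], and that [Q] applied to [rho phi] cancels the jump term
    (present for [k = 0] only) for all [phi] of degree at most [r - k]. The
    equations for [Ut] ask that [rt] vanish to one order more at each end, that
    [Ut] be continuous at [a], and that [rt phi] have integral zero for all
    [phi] of degree below [r - k]; the last form is legitimate because both
    rules are exact up to degree [2r - k].

    The correction [th] is a multiple of [om], so it is orthogonal to degrees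
    below [r - k]. Integrating [th' phi] by parts shows that the correction
    changes the tested residual only by turning the jump of [U] into the jump
    of [Ut] ([corrected_test]). This gives the variational equation as soon as
    [Ut] is continuous.

    The point is that the two missing orders at the end points are equivalent
    ([corrected_a_of_b], [corrected_b_of_a]; for [k = 0] the condition at [a] is
    continuity, [jump_of_b]). Test with [phi = w], of degree [r - k], where [Q]
    is not exact: applying [Q] means integrating the remainder modulo [om]
    ([quad_contact]), and for [rt w] that remainder only remembers the missing
    order at either end, with weights that are not zero
    ([deficient_end_factor]). If one vanishes, so does the other.

    The residual-based coefficient supplies the missing order at [b]. The
    jump-based one supplies it at [a], by induction over the mesh: the
    derivatives arriving at [t n] from the left satisfy the differentiated
    equation ([incoming_ode]), and the correction makes [Ut] continue them.

    The quadrature makes sense because Jacobi polynomials exist and have simple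
    zeros inside the interval ([orthogonal_polynomial_roots]). Functions such
    as [f] enter only through polynomials with the same one-sided Taylor data
    ([contact]). *)

Set Implicit Arguments.
Unset Strict Implicit.
Unset Printing Implicit Defensive.

(** * Integrals of polynomials *)

Section PolynomialIntegral.
Context {R : realType}.
Implicit Types (p q P : {poly R}) (a b c x y : R).

(** For [i = 0] the quotient is [x / 0 = 0], so the constant term vanishes. *)
Definition primitive p : {poly R} := \poly_(i < (size p).+1) (p`_i.-1 / i%:R).

Lemma deriv_primitive p : (primitive p)^`() = p.
Proof.
apply/polyP => i; rewrite coef_deriv coef_poly ltnS /=.
case: ltnP => [_|hi]; last by rewrite mul0rn nth_default.
by rewrite -(mulr_natr (_ / _)) divfK // pnatr_eq0.
Qed.

Lemma deriv_eq0 p : p^`() = 0 -> p = (p`_0)%:P.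
Proof.
move=> hp; apply/polyP => -[|i]; rewrite coefC //=.
have := congr1 (fun s : {poly R} => s`_i) hp; rewrite coef_deriv coef0 => /eqP.
by rewrite mulrn_eq0 /= => /eqP.
Qed.

(** The integral of a polynomial, as a difference of values of a primitive: with
    it linearity, integration by parts and substitution are polynomial
    identities. *)
Definition pint a b p : R := (primitive p).[b] - (primitive p).[a].

Lemma pintE a b P : pint a b P^`() = P.[b] - P.[a].
Proof.
have h : (primitive P^`() - P)^`() = 0 by rewrite derivB deriv_primitive subrr.
have E : primitive P^`() = P + ((primitive P^`() - P)`_0)%:P.
  by rewrite -(deriv_eq0 h) addrC subrK.
by rewrite /pint E !(hornerD, hornerC); ring.
Qed.

Lemma pintD a b p q : pint a b (p + q) = pint a b p + pint a b q.
Proof.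
rewrite -{1}(deriv_primitive p) -{1}(deriv_primitive q) -derivD pintE.
by rewrite !hornerD /pint; ring.
Qed.

Lemma pintZ a b c p : pint a b (c *: p) = c * pint a b p.
Proof.
by rewrite -{1}(deriv_primitive p) -derivZ pintE !hornerZ /pint mulrBr.
Qed.

Lemma pint0 a b : pint a b 0 = 0.
Proof. by rewrite -(scale0r (0 : {poly R})) pintZ mul0r. Qed.

Lemma pintN a b p : pint a b (- p) = - pint a b p.
Proof. by rewrite -scaleN1r pintZ mulN1r. Qed.

Lemma pintB a b p q : pint a b (p - q) = pint a b p - pint a b q.
Proof. by rewrite pintD pintN. Qed.

Lemma pint_parts a b p q :
  pint a b (p^`() * q) =
  p.[b] * q.[b] - p.[a] * q.[a] - pint a b (p * q^`()).
Proof.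
have -> : p^`() * q = (p * q)^`() - p * q^`() by rewrite derivM addrK.
by rewrite pintB pintE !hornerM.
Qed.

Lemma continuous_horner p : continuous (horner p).
Proof.
by move=> x; apply: differentiable_continuous; apply/derivable1_diffP/derivable_horner.
Qed.

Lemma Rintegral_horner a b p : a < b ->
  \int[lebesgue_measure]_(x in `[a, b]) p.[x] = pint a b p.
Proof.
move=> ab; rewrite /Rintegral (@continuous_FTC2 _ (horner p) (horner (primitive p))) //.
- exact/continuous_subspaceT/continuous_horner.
- split=> [x _||]; first exact: derivable_horner.
  + exact/cvg_at_right_filter/continuous_horner.
  + exact/cvg_at_left_filter/continuous_horner.
- by move=> x _; rewrite -derivE deriv_primitive.
Qed.

(** Otherwise the polynomial would have more roots than its degree allows. *)
Lemma itvoo_poly0 a b p : a < b -> {in `]a, b[, forall x, p.[x] = 0} -> p = 0.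
Proof.
move=> ab h; apply/eqP/negPn/negP => p0.
(* as many interior points as the size of p, one more than its degree *)
pose s := [seq a + (b - a) * (i.+1%:R / (size p).+1%:R) | i <- iota 0 (size p)].
have ss : size s = size p by rewrite size_map size_iota.
suff : (size s < size p)%N by rewrite ss ltnn.
apply: max_poly_roots => //.
- apply/allP => _ /mapP[i hi ->]; rewrite /root h // in_itv /=.
  rewrite mem_iota add0n in hi.
  have h1 : 0 < i.+1%:R / (size p).+1%:R :> R by rewrite divr_gt0 ?ltr0n.
  have h2 : i.+1%:R / (size p).+1%:R < 1 :> R.
    by rewrite ltr_pdivrMr ?ltr0n // mul1r ltr_nat.
  have ba : 0 < b - a by rewrite subr_gt0.
  rewrite ltrDl mulr_gt0 //= -ltrBrDl.
  by rewrite -[ltRHS]mulr1 ltr_pM2l.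
- have ba : b - a != 0 by rewrite subr_eq0 gt_eqF.
  rewrite map_inj_uniq ?iota_uniq // => i j /addrI /(mulfI ba).
  have n0 : (size p).+1%:R^-1 != 0 :> R by rewrite invr_eq0 pnatr_eq0.
  by move=> /(mulIf n0) /eqP; rewrite eqr_nat eqSS => /eqP.
Qed.

(** A primitive of a nonnegative polynomial is nondecreasing, and if its values
    at both ends agree it is constant on the interval, hence everywhere. *)
Lemma pint_gt0 a b p : a < b -> {in `]a, b[, forall x, 0 <= p.[x]} ->
  p != 0 -> 0 < pint a b p.
Proof.
move=> ab hp p0.
have mono x y : a <= x -> x <= y -> y <= b -> (primitive p).[x] <= (primitive p).[y].
  move=> ax xy yb.
  apply: (@ger0_derive1_ndecr _ (horner (primitive p)) a b) => //.
  + by move=> z hz; rewrite -derivE deriv_primitive; exact: hp.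
  + exact/continuous_subspaceT/continuous_horner.
rewrite lt_def; apply/andP; split; last first.
  by rewrite /pint subr_ge0; apply: mono => //; exact: ltW.
rewrite /pint.
apply: contraNneq p0 => /eqP; rewrite subr_eq0 => /eqP hab.
suff E : primitive p - ((primitive p).[a])%:P = 0.
  by rewrite -(deriv_primitive p) (subr0_eq E) derivC.
apply: (itvoo_poly0 ab) => x; rewrite in_itv /= => /andP[/ltW ax /ltW xb].
rewrite !hornerE; apply/eqP; rewrite subr_eq0 eq_le -{1}hab !mono //.
Qed.

(** [from_ref] and [to_ref] as polynomials, so that they can be composed with polynomials. *)
Definition from_poly a b : {poly R} := ((b - a) / 2)%:P * 'X + ((a + b) / 2)%:P.
Definition to_poly a b : {poly R} := (2 / (b - a))%:P * 'X - ((a + b) / (b - a))%:P.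

Lemma horner_from a b x : (from_poly a b).[x] = from_ref a b x.
Proof. by rewrite !hornerE /from_ref; field. Qed.

Lemma horner_to a b x : (to_poly a b).[x] = to_ref a b x.
Proof. by rewrite !hornerE /to_ref mulrBl mulrAC. Qed.

Lemma from_toK a b x : a < b -> from_ref a b (to_ref a b x) = x.
Proof. by move=> ab; rewrite /from_ref /to_ref; field; rewrite subr_eq0 gt_eqF. Qed.

Lemma to_fromK a b x : a < b -> to_ref a b (from_ref a b x) = x.
Proof. by move=> ab; rewrite /from_ref /to_ref; field; rewrite subr_eq0 gt_eqF. Qed.

Lemma to_poly_comp a b : a < b -> to_poly a b \Po from_poly a b = 'X.
Proof.
move=> ab.
rewrite /to_poly comp_polyB comp_polyM !comp_polyC comp_polyX /from_poly mulrDr.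
rewrite !mulrA -!polyCM -addrA -polyCB.
have -> : 2 / (b - a) * ((b - a) / 2) = 1 by field; rewrite subr_eq0 gt_eqF.
have -> : 2 / (b - a) * ((a + b) / 2) - (a + b) / (b - a) = 0.
  by field; rewrite subr_eq0 gt_eqF.
by rewrite mul1r addr0.
Qed.

Lemma from_poly_comp a b : a < b -> from_poly a b \Po to_poly a b = 'X.
Proof.
move=> ab.
rewrite /from_poly comp_polyD comp_polyM !comp_polyC comp_polyX /to_poly mulrBr.
rewrite !mulrA -!polyCM -addrA -polyCN -polyCD.
have -> : (b - a) / 2 * (2 / (b - a)) = 1 by field; rewrite subr_eq0 gt_eqF.
have -> : - ((b - a) / 2 * ((a + b) / (b - a))) + (a + b) / 2 = 0.
  by field; rewrite subr_eq0 gt_eqF.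
by rewrite mul1r addr0.
Qed.

Lemma pint_from_ref a b p : a < b ->
  pint a b p = (b - a) / 2 * pint (-1) 1 (p \Po from_poly a b).
Proof.
move=> ab; pose P := primitive p.
have -> : p \Po from_poly a b = (2 / (b - a)) *: (P \Po from_poly a b)^`().
  have dF : (from_poly a b)^`() = ((b - a) / 2)%:P.
    by rewrite /from_poly derivD derivM !derivC derivX mul0r add0r mulr1 addr0.
  rewrite deriv_comp deriv_primitive dF [_ * _%:P]mulrC mul_polyC scalerA.
  by rewrite (_ : 2 / (b - a) * _ = 1) ?scale1r //; field; rewrite subr_eq0 gt_eqF.
rewrite pintZ pintE !horner_comp !horner_from /pint -/P.
have -> : from_ref a b 1 = b by rewrite /from_ref; field.
have -> : from_ref a b (-1) = a by rewrite /from_ref; field.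
by field; rewrite subr_eq0 gt_eqF.
Qed.

End PolynomialIntegral.

(** * Orthogonal polynomials for a positive weight *)

Section OrthogonalPolynomials.
Context {R : realType} (a b : R) (W : {poly R}).
Hypothesis ab : a < b.
Hypothesis Wgt0 : {in `]a, b[, forall x, 0 < W.[x]}.
Implicit Types (p q P D E : {poly R}).

Lemma weighted_pint_gt0 q : {in `]a, b[, forall x, 0 <= q.[x]} -> q != 0 ->
  0 < pint a b (W * q).
Proof.
move=> hq q0; apply: pint_gt0 => // [x hx|].
  by rewrite hornerM mulr_ge0 ?hq // ltW // Wgt0.
rewrite mulf_neq0 //; apply/negP => /eqP W0.
have hm : (a + b) / 2 \in `]a, b[ by rewrite in_itv /= !midf_lt.
by have := Wgt0 hm; rewrite W0 horner0 ltxx.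
Qed.

(** Gram-Schmidt: the residual of the monomial ['X^n] after projection onto
    degrees below [n] is orthogonal to them and has positive norm; subtracting
    its multiple improves the projection by one degree. *)
Lemma orthogonal_projection n p : exists2 s : {poly R}, (size s <= n)%N &
  forall q, (size q <= n)%N -> pint a b (W * (p - s) * q) = 0.
Proof.
elim: n p => [|n IH] p.
  exists 0; rewrite ?size_poly0 // => q; rewrite leqn0 size_poly_eq0 => /eqP->.
  by rewrite mulr0 pint0.
have [e0 se0 he0] := IH 'X^n.
have [s ss hs] := IH p.
pose e := 'X^n - e0.
have se : size e = n.+1 by rewrite size_polyDl size_polyXn // size_polyN.
have en : e`_n = 1 by rewrite coefB coefXn eqxx (nth_default _ se0) subr0.
have e_neq0 : e != 0 by rewrite -size_poly_eq0 se.
have ee_gt0 : 0 < pint a b (W * e * e).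
  rewrite -mulrA; apply: weighted_pint_gt0; last by rewrite mulf_neq0.
  by move=> x _; rewrite hornerM -expr2 sqr_ge0.
pose c := pint a b (W * (p - s) * e) / pint a b (W * e * e).
exists (s + c *: e) => [|q sq].
  rewrite (leq_trans (size_polyD _ _)) // geq_max (leq_trans ss) //=.
  by rewrite (leq_trans (size_scale_leq _ _)) // se.
pose q' := q - q`_n *: e.
have sq' : (size q' <= n)%N.
  apply/leq_sizeP => j; rewrite leq_eqVlt => /predU1P[<-|nj].
    by rewrite coefB coefZ en mulr1 subrr.
  by rewrite coefB coefZ (nth_default _ (leq_trans sq nj)) (@nth_default _ _ e) ?se // mulr0 subrr.
have -> : W * (p - (s + c *: e)) * q = (W * (p - s) * q' - c *: (W * e * q'))
    + q`_n *: (W * (p - s) * e - c *: (W * e * e)).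
  rewrite /q' -!mul_polyC; ring.
rewrite pintD pintB !pintZ pintB pintZ hs // he0 // mulr0 subrr add0r.
by rewrite /c divfK ?subrr ?mulr0 // gt_eqF.
Qed.

(** Projecting the monomial of degree n away from lower degrees. *)
Lemma orthogonal_polynomial_exists n : exists P : {poly R},
  [/\ P \is monic, size P = n.+1
    & forall q, (size q <= n)%N -> pint a b (W * P * q) = 0].
Proof.
have [s ss hs] := orthogonal_projection n 'X^n.
have sP : size ('X^n - s) = n.+1 by rewrite size_polyDl size_polyXn // size_polyN.
exists ('X^n - s); split=> //.
by rewrite monicE lead_coefE sP /= coefB coefXn eqxx (nth_default _ ss) subr0.
Qed.

(** [s] lists the roots in the interval with their multiplicities. *)
Lemma split_roots P : P != 0 -> exists s : seq R, exists2 D : {poly R},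
  P = \prod_(x <- s) ('X - x%:P) * D &
  all (mem `]a, b[) s /\ {in `]a, b[, forall x, ~~ root D x}.
Proof.
have [n] := ubnP (size P); elim: n P => // n IH P sP P0.
have [[x hx rx]|noroot] := pselect (exists2 x, x \in `]a, b[ & root P x).
  move/factor_theorem: rx => [Q PQ].
  have Q0 : Q != 0 by apply: contraNneq P0 => Q0; rewrite PQ Q0 mul0r.
  have [|//|s [D QD [hs hD]]] := IH Q.
    by move: sP; rewrite PQ size_mul ?polyXsubC_eq0 // size_XsubC addn2.
  exists (x :: s); exists D; last by split=> //=; rewrite hx.
  by rewrite big_cons PQ QD mulrC mulrA.
exists [::]; exists P; first by rewrite big_nil mul1r.
by split=> // x hx; apply/negP => rx; apply: noroot; exists x.
Qed.

(** The intermediate value theorem for polynomials. *)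
Lemma noroot_sign D x y : {in `]a, b[, forall x, ~~ root D x} ->
  x \in `]a, b[ -> y \in `]a, b[ -> D.[x] <= 0 -> 0 <= D.[y] -> False.
Proof.
move=> hD; rewrite !in_itv /= => /andP[ax xb] /andP[ay yb] Dx Dy.
have [xy|/ltW yx] := leP x y.
  have [|z /andP[xz zy] rz] := @poly_ivt _ D x y xy; first by rewrite Dx.
  by move: (hD z); rewrite rz in_itv /= (lt_le_trans ax xz) (le_lt_trans zy yb) => /(_ isT).
have [|z /andP[yz zx]] := @poly_ivt _ (- D) y x yx.
  by rewrite !hornerN oppr_le0 oppr_ge0 Dx Dy.
rewrite rootN => rz.
by move: (hD z); rewrite rz in_itv /= (lt_le_trans ay yz) (le_lt_trans zx xb) => /(_ isT).
Qed.

Context (n : nat) (P : {poly R}).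
Hypotheses (Pmonic : P \is monic) (Psize : size P = n.+1).
Hypothesis Porth : forall q, (size q <= n)%N -> pint a b (W * P * q) = 0.

(** Otherwise the cofactor E of D has degree below n, and testing with E
    integrates the nonnegative polynomial W D E^2 to zero. *)
Lemma orthogonal_no_nonneg_factor D E : P = D * E ->
  {in `]a, b[, forall x, 0 <= D.[x]} -> (size D <= 1)%N.
Proof.
move=> PDE hD; rewrite leqNgt; apply/negP => sD.
have P0 : P != 0 by rewrite -size_poly_eq0 Psize.
have D0 : D != 0 by apply: contraNneq P0 => D0; rewrite PDE D0 mul0r.
have E0 : E != 0 by apply: contraNneq P0 => E0; rewrite PDE E0 mulr0.
have sE : (size E <= n)%N.
  have := Psize; rewrite PDE size_mul // => h; move: sD h; case: (size D) => // -[|m] // _.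
  by rewrite !addSn /= => -[<-]; rewrite leq_addl.
have := Porth sE; rewrite PDE -mulrA => h.
have : 0 < pint a b (W * (D * E * E)).
  apply: weighted_pint_gt0 => [x hx|]; last by rewrite !mulf_neq0.
  by rewrite -mulrA !hornerM mulr_ge0 ?hD // -expr2 sqr_ge0.
by rewrite h ltxx.
Qed.

(** A repeated root in the interval or a cofactor without roots there would
    give a nonconstant factor of constant sign. *)
Lemma orthogonal_polynomial_roots : exists s : seq R,
  [/\ uniq s, size s = n, all (mem `]a, b[) s & P = \prod_(x <- s) ('X - x%:P)].
Proof.
have P0 : P != 0 by rewrite -size_poly_eq0 Psize.
have [s [D PD [hs hD]]] := split_roots P0.
have D0 : D != 0 by apply: contraNneq P0 => D0; rewrite PD D0 mulr0.
have sD : (size D <= 1)%N.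
  have [[x hx Dx]|hpos] := pselect (exists2 x, x \in `]a, b[ & D.[x] <= 0).
    rewrite -size_polyN; apply: (@orthogonal_no_nonneg_factor _ (- \prod_(x <- s) ('X - x%:P))).
      by rewrite mulrNN mulrC.
    move=> y hy; rewrite hornerN oppr_ge0 leNgt; apply/negP => /ltW Dy.
    exact: (noroot_sign hD hx hy).
  apply: (@orthogonal_no_nonneg_factor _ (\prod_(x <- s) ('X - x%:P))).
    by rewrite mulrC.
  by move=> y hy; rewrite leNgt; apply/negP => /ltW Dy; apply: hpos; exists y.
have PE : P = \prod_(x <- s) ('X - x%:P).
  move: Pmonic; rewrite PD (size1_polyC sD) monicMl ?monic_prod_XsubC //.
  by rewrite monicE lead_coefC => /eqP->; rewrite mulr1.
exists s; split=> //; last by have := Psize; rewrite PE size_prod_XsubC => -[].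
apply: count_mem_uniq => x; have [xs|/count_memPn->//] := boolP (x \in s).
have ps := perm_to_rem xs; rewrite (permP ps) /= eqxx.
suff /count_memPn-> : x \notin rem x s by [].
apply/negP => /perm_to_rem ps'.
have : (size (('X - x%:P) ^+ 2 : {poly R}) <= 1)%N.
  apply: (@orthogonal_no_nonneg_factor _ (\prod_(y <- rem x (rem x s)) ('X - y%:P))).
    by rewrite PE (perm_big _ ps) big_cons (perm_big _ ps') big_cons /= mulrA.
  by move=> y _; rewrite horner_exp sqr_ge0.
by rewrite size_exp_XsubC.
Qed.

End OrthogonalPolynomials.

(** * Divisibility, derivatives and gluing of polynomials *)

Section Multiplicity.
Context {R : realType}.
Implicit Types (p q u v : {poly R}) (c : R).

(** Each derivative takes one factor ['X - c] away; [v.[c]] records the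
    coefficient that survives at [c]. *)
Lemma derivn_XsubC_exp c m n u : exists2 v,
  (('X - c%:P) ^+ (m + n) * u)^`(n) = ('X - c%:P) ^+ m * v &
  v.[c] = ((m + n) ^_ n)%:R * u.[c].
Proof.
elim: n u => [|n IH] u; first by exists u; rewrite ?addn0 // ffactn0 mul1r.
have [v hv vc] := IH ((m + n.+1)%:R *: u + ('X - c%:P) * u^`()).
exists v.
  rewrite -hv derivSn; congr (_^`(_)).
  rewrite derivM deriv_exp derivXsubC mul1r addnS /= exprS scaler_nat.
  by rewrite -mulr_natr -[_ *+ _ in RHS]mulr_natr; ring.
rewrite vc hornerD hornerZ hornerM hornerXsubC subrr mul0r addr0 addnS ffactSS natrM; ring.
Qed.

Lemma derivn_XsubC_exp_eq0 c n j u : (j < n)%N ->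
  ((('X - c%:P) ^+ n * u)^`(j)).[c] = 0.
Proof.
move=> jn; have [v] := derivn_XsubC_exp c (n - j) j u.
rewrite subnK ?(ltnW jn) // => -> _.
by rewrite hornerM horner_exp hornerXsubC subrr expr0n subn_eq0 leqNgt jn mul0r.
Qed.

Lemma derivn_XsubC_exp_lead c n u :
  ((('X - c%:P) ^+ n * u)^`(n)).[c] = n`!%:R * u.[c].
Proof.
by have [v] := derivn_XsubC_exp c 0 n u; rewrite add0n mul1r => -> ->; rewrite ffactnn.
Qed.

Lemma dvdp_XsubC_expP c n p :
  ('X - c%:P) ^+ n %| p <-> forall j, (j < n)%N -> (p^`(j)).[c] = 0.
Proof.
split=> [/dvdpP[u ->] j jn|]; first by rewrite mulrC derivn_XsubC_exp_eq0.
elim: n => [|n IH] h; first by rewrite expr0 dvd1p.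
have /dvdpP[u pu] : ('X - c%:P) ^+ n %| p by apply: IH => j /ltnW; exact: h.
have /eqP := h n (ltnSn n); rewrite pu mulrC derivn_XsubC_exp_lead mulf_eq0.
rewrite pnatr_eq0 gtn_eqF ?fact_gt0 //= => /factor_theorem[v ->].
by rewrite mulrCA -exprSr dvdp_mull.
Qed.

Lemma chinese_poly p q u v : coprimep p q ->
  exists2 w : {poly R}, p %| w - u & q %| w - v.
Proof.
move=> /Bezout_eq1_coprimepP[[x y] /= xy].
exists (u * (y * q) + v * (x * p)).
  have -> : u * (y * q) + v * (x * p) - u = (v - u) * x * p.
    rewrite -[X in _ - X]mulr1 -xy; ring.
  exact: dvdp_mull.
have -> : u * (y * q) + v * (x * p) - v = (u - v) * y * q.
  rewrite -[X in _ - X]mulr1 -xy; ring.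
exact: dvdp_mull.
Qed.

Lemma lagrange_exists (xs : seq R) (h : R -> R) : uniq xs ->
  exists G : {poly R}, {in xs, forall x, G.[x] = h x}.
Proof.
elim: xs => [|x xs IH] /=; first by exists 0.
move=> /andP[xxs /IH[G hG]].
pose P := \prod_(y <- xs) ('X - y%:P).
have rP y : (P.[y] == 0) = (y \in xs) by rewrite -root_prod_XsubC.
clearbody P; exists (G + ((h x - G.[x]) / P.[x]) *: P) => y.
rewrite hornerD hornerZ inE => /predU1P[->|yxs].
  by rewrite divfK ?rP // addrC subrK.
have /eqP-> : P.[y] == 0 by rewrite rP.
by rewrite mulr0 addr0 hG.
Qed.

End Multiplicity.

(** * One-sided Taylor data *)

Section Contact.
Context {R : realType}.
Implicit Types (g h : R -> R) (G H L : {poly R}) (F : set_system R) (lo hi c : R).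

(** [g] and [G] have the same first [n] one-sided Taylor data at [c] (orders 0
    to [n - 1]), limits being taken along [F], a one-sided neighbourhood filter
    at [c], and derivatives of [g] on the open interval only. Differentiability
    is asked for the orders below [n - 1]. The recursion on the derivative
    turns the product rule [contactM] into a plain induction. *)
Fixpoint contact F c lo hi n g G : Prop :=
  if n is n'.+1 then
    [/\ g x @[x --> F] --> G.[c],
        (0 < n')%N -> {in `]lo, hi[, forall x, derivable g x 1}
      & contact F c lo hi n' (derive1 g) G^`()]
  else True.

Lemma derive1_itvoo_eq lo hi g h : {in `]lo, hi[, g =1 h} ->
  {in `]lo, hi[, (derive1 g) =1 (derive1 h)}.
Proof.
move=> gh x xI; rewrite !derive1E; apply: near_eq_derive.
by near=> y; apply: gh; near: y; exact: near_in_itvoo.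
Unshelve. all: by end_near. Qed.

Lemma derivable_itvoo_eq lo hi g h : {in `]lo, hi[, g =1 h} ->
  {in `]lo, hi[, forall x, derivable g x 1} ->
  {in `]lo, hi[, forall x, derivable h x 1}.
Proof.
move=> gh dg x xI; apply: near_eq_derivable (dg x xI).
by near=> y; apply: gh; near: y; exact: near_in_itvoo.
Unshelve. all: by end_near. Qed.

Section OneFilter.
Variables (F : set_system R) (c lo hi : R).
Context {FF : ProperFilter F}.
Hypothesis FI : F [set` `]lo, hi[].
Hypothesis Fc : F --> c.

Local Notation ctc := (contact F c lo hi).

Lemma contact_weaken n g G : ctc n.+1 g G -> ctc n g G.
Proof.
elim: n g G => [//|n IH] g G [gG dg cg]; split=> // [n0|]; first exact: dg.
exact: IH.
Qed.

Lemma contact_eq_itv n g h G : {in `]lo, hi[, g =1 h} -> ctc n g G -> ctc n h G.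
Proof.
elim: n g h G => [//|n IH] g h G gh [gG dg cg]; split.
- apply: cvg_trans gG; apply: near_eq_cvg.
  by apply: filterS FI => x /gh.
- by move=> /dg; exact: derivable_itvoo_eq.
- by apply: IH cg; exact: derive1_itvoo_eq.
Qed.

Lemma contact_horner n G : ctc n (horner G) G.
Proof.
elim: n G => [//|n IH] G; split.
- exact: (cvg_comp _ _ Fc (continuous_horner (x := c))).
- by move=> _ x _; exact: derivable_horner.
- by rewrite -derivE; exact: IH.
Qed.

Lemma contactD n g G h H : ctc n g G -> ctc n h H ->
  ctc n (fun x => g x + h x) (G + H).
Proof.
elim: n g G h H => [//|n IH] g G h H [gG dg cg] [hH dh ch]; split.
- by rewrite hornerD; exact: cvgD.
- by move=> n0 x xI; apply: derivableD; [exact: dg|exact: dh].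
- case: n IH dg dh cg ch => [//|n] IH dg dh cg ch.
  rewrite derivD; apply: contact_eq_itv (IH _ _ _ _ cg ch) => x xI.
  by rewrite !derive1E deriveD //; [exact: dg|exact: dh].
Qed.

(** The Leibniz rule for one-sided Taylor data. *)
Lemma contactM n g G h H : ctc n g G -> ctc n h H ->
  ctc n (fun x => g x * h x) (G * H).
Proof.
elim: n g G h H => [//|n IH] g G h H cg' ch'.
have [gG dg cg] := cg'; have [hH dh ch] := ch'; split.
- by rewrite hornerM; exact: cvgM.
- by move=> n0 x xI; apply: derivableM; [exact: dg|exact: dh].
- case: n IH cg' ch' dg dh cg ch => [//|n] IH cg' ch' dg dh cg ch.
  rewrite derivM.
  apply: contact_eq_itv (contactD (IH _ _ _ _ cg (contact_weaken ch'))
                                  (IH _ _ _ _ (contact_weaken cg') ch)) => x xI.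
  rewrite !derive1E [in RHS]deriveM; [|exact: dg|exact: dh].
  by rewrite /= addrC [_ * h x]mulrC.
Qed.

Lemma contact_eq_poly n g G H :
  (forall j, (j < n)%N -> (G^`(j)).[c] = (H^`(j)).[c]) ->
  ctc n g G -> ctc n g H.
Proof.
elim: n g G H => [//|n IH] g G H GH [gG dg cg]; split=> //.
  by have := GH 0%N isT; rewrite !derivn0 => <-.
by apply: IH cg => j jn; rewrite -!derivSn GH.
Qed.

Lemma contact_lim n g G j : ctc n g G -> (j < n)%N ->
  lim (derive1n j g x @[x --> F]) = (G^`(j)).[c].
Proof.
elim: n g G j => [//|n IH] g G [|j] [gG dg cg] jn.
  by rewrite derivn0; exact: cvg_lim.
by rewrite derivSn -(IH (derive1 g)) // /derive1n iterSr.
Qed.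

(** The Taylor polynomial is obtained by integrating that of the derivative. *)
Lemma contact_exists n g :
  (forall j, (j < n)%N -> cvg (derive1n j g x @[x --> F])) ->
  (forall j x, (j.+1 < n)%N -> x \in `]lo, hi[ -> derivable (derive1n j g) x 1) ->
  exists G, ctc n g G.
Proof.
elim: n g => [|n IH] g cg dg; first by exists 0.
have [j jn|j x jn|G hG] := IH (derive1 g).
- by rewrite /derive1n -iterSr; exact: (cg j.+1).
- by rewrite /derive1n -iterSr; exact: (dg j.+1).
pose l := lim (g x @[x --> F]).
exists (primitive G + (l - (primitive G).[c])%:P); split.
- by rewrite hornerD hornerC addrC subrK; exact: (cg 0%N).
- by move=> n0 x xI; exact: (dg 0%N).
- by rewrite derivD derivC addr0 deriv_primitive.
Qed.

End OneFilter.

(** The chain rule for one-sided Taylor data under a polynomial substitution. *)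
Lemma contact_comp F c lo hi F' c' lo' hi' n g G L :
  ProperFilter F' -> F' [set` `]lo', hi'[] -> F' --> c' ->
  c = L.[c'] ->
  {in `]lo', hi'[, forall x, L.[x] \in `]lo, hi[} ->
  L.[x] @[x --> F'] --> F ->
  contact F c lo hi n g G ->
  contact F' c' lo' hi' n (g \o horner L) (G \Po L).
Proof.
move=> PF FI Fc cL LI LF; elim: n g G => [//|n IH] g G [gG dg cg]; split.
- by rewrite horner_comp -cL; exact: cvg_comp LF gG.
- move=> n0 x xI; apply/derivable1_diffP; apply: differentiable_comp.
    exact/derivable1_diffP/derivable_horner.
  by apply/derivable1_diffP; apply: dg => //; exact: LI.
- case: n IH dg cg => [//|n] IH dg cg.
  rewrite deriv_comp.
  apply: contact_eq_itv (contactM FI (IH _ _ cg) (contact_horner lo' hi' Fc _ _)) => // x xI.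
  rewrite derive1_comp; [by rewrite derivE|exact: derivable_horner|].
  by apply: dg => //; exact: LI.
Qed.

End Contact.

(** * Quadrature points on an interval *)

Section Nodes.
Context {R : realType}.
Implicit Types (p q G H Z : {poly R}) (g h : R -> R) (s m n i j : nat).

Lemma jacobiP al be n : is_jacobi al be n (jacobi al be n : {poly R}).
Proof.
apply: xgetPex; pose W : {poly R} := (1 + 'X) ^+ al * (1 - 'X) ^+ be.
have Wgt0 : {in `]-1, 1[, forall x : R, 0 < W.[x]}.
  move=> x; rewrite in_itv /= => /andP[x1 x2].
  rewrite !(hornerM, horner_exp, hornerD, hornerN, hornerX, hornerC).
  by rewrite mulr_gt0 // exprn_gt0 //; lra.
have [|P [Pm Ps Po]] := @orthogonal_polynomial_exists R (-1) 1 W _ Wgt0 n.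
  by rewrite gtrN.
exists P; split=> // q /Po; rewrite -Rintegral_horner ?gtrN // => E.
rewrite -[RHS]E; congr Rintegral; apply/funext => x.
by rewrite !(hornerM, horner_exp, hornerD, hornerN, hornerX, hornerC).
Qed.

Lemma jacobi_orthogonal al be n q : (size q <= n)%N ->
  pint (-1) 1 ((1 + 'X) ^+ al * (1 - 'X) ^+ be * jacobi al be n * q) = 0 :> R.
Proof.
have [_ _ h] := jacobiP al be n => /h E.
rewrite -Rintegral_horner ?gtrN // -[RHS]E; congr Rintegral; apply/funext => x.
by rewrite !(hornerM, horner_exp, hornerD, hornerN, hornerX, hornerC).
Qed.

(** The interior quadrature points are distinct and lie in the open reference
    interval, hence differ from the end points. *)
Lemma ref_node_poly_roots s m : exists xs : seq R,
  [/\ uniq xs, size xs = (s - m)%N, all (mem `]-1, 1[) xs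
    & ref_node_poly s m = \prod_(x <- xs) ('X - x%:P)].
Proof.
have [Pm Ps _] := jacobiP (uphalf m) m./2.+1 (s - m).
apply: (@orthogonal_polynomial_roots R (-1) 1
  ((1 + 'X) ^+ uphalf m * (1 - 'X) ^+ m./2.+1)) => //.
- move=> x; rewrite in_itv /= => /andP[x1 x2].
  rewrite !(hornerM, horner_exp, hornerD, hornerN, hornerX, hornerC).
  by rewrite mulr_gt0 // exprn_gt0 //; lra.
- by move=> q; exact: jacobi_orthogonal.
Qed.

Lemma root_ref_node_poly s m (x : R) : root (ref_node_poly s m) x -> x \in `]-1, 1[.
Proof.
by have [xs [_ _ /allP hxs ->]] := ref_node_poly_roots s m; rewrite root_prod_XsubC => /hxs.
Qed.

Section OneInterval.
Variables (a b : R).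
Hypothesis ab : a < b.

Let ba0 : b - a != 0. Proof. by rewrite subr_eq0 gt_eqF. Qed.

(** The Jacobi polynomial carried over to [[a, b]]: its roots are the interior nodes. *)
Definition inner_poly s m : {poly R} := ref_node_poly s m \Po to_poly a b.

(** Its zeros are the quadrature points with their multiplicities, so that
    polynomials with the same node data differ by its multiples. *)
Definition nodal s m : {poly R} :=
  ('X - a%:P) ^+ uphalf m * ('X - b%:P) ^+ m./2.+1 * inner_poly s m.


Lemma inner_poly_from s m : inner_poly s m \Po from_poly a b = ref_node_poly s m.
Proof. by rewrite /inner_poly -comp_polyA to_poly_comp // comp_polyXr. Qed.

Lemma comp_from_inj p : p \Po from_poly a b \Po to_poly a b = p.
Proof. by rewrite -comp_polyA from_poly_comp // comp_polyXr. Qed.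

Lemma size_from_poly : size (from_poly a b) = 2.
Proof.
have c0 : (b - a) / 2 != 0 by rewrite mulf_neq0 // invr_eq0 pnatr_eq0.
rewrite /from_poly size_polyDl size_Cmul ?size_polyX //.
by rewrite ltnS size_polyC_leq1.
Qed.

Lemma size_comp_from p : size (p \Po from_poly a b) = size p.
Proof. by rewrite size_comp_poly2 // size_from_poly. Qed.

Lemma size_inner_poly s m : size (inner_poly s m) = (s - m).+1.
Proof.
by rewrite -size_comp_from inner_poly_from; have [] := jacobiP (uphalf m) m./2.+1 (s - m).
Qed.

Lemma inner_poly_neq0 s m : inner_poly s m != 0.
Proof. by rewrite -size_poly_eq0 size_inner_poly. Qed.

Lemma from_ref_itv x : x \in `]-1, 1[ -> from_ref a b x \in `]a, b[.
Proof.
rewrite !in_itv /= /from_ref => /andP[x1 x2].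
have h1 : 0 < (b - a) * (1 + x) by rewrite mulr_gt0 ?subr_gt0 //; lra.
have h2 : 0 < (b - a) * (1 - x) by rewrite mulr_gt0 ?subr_gt0.
by apply/andP; split; lra.
Qed.

Lemma inner_poly_end s m x : x \notin `]a, b[ -> ~~ root (inner_poly s m) x.
Proof.
apply: contra; rewrite /root horner_comp horner_to => /root_ref_node_poly/from_ref_itv.
by rewrite from_toK.
Qed.

(** Divisibility amounts to vanishing at the nodes because they are simple. *)
Lemma dvdp_inner_polyP s m p : inner_poly s m %| p <->
  forall x, root (ref_node_poly s m) x -> root p (from_ref a b x).
Proof.
split=> [/dvdpP[u ->] x rx|h].
  by rewrite rootM /inner_poly orbC [root (_ \Po _) _]/root
    horner_comp horner_to to_fromK // -[_ == _]/(root _ x) rx.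
have [xs [uxs _ _ E]] := ref_node_poly_roots s m.
have : ref_node_poly s m %| p \Po from_poly a b.
  rewrite E; apply: uniq_roots_dvdp; last by rewrite uniq_rootsE.
  apply/allP => x xxs; rewrite /root horner_comp horner_from; apply: h.
  by rewrite E root_prod_XsubC.
by case/dvdpP => u hu; rewrite -(comp_from_inj p) hu comp_polyM dvdp_mull.
Qed.

Lemma coprimep_ends i j : coprimep (('X - a%:P) ^+ i) (('X - b%:P) ^+ j).
Proof. by apply: coprimep_expl; apply: coprimep_expr; apply: coprimep_XsubC2. Qed.

Lemma coprimep_inner_end s m c i : c \notin `]a, b[ ->
  coprimep (inner_poly s m) (('X - c%:P) ^+ i).
Proof. by move=> /inner_poly_end h; apply: coprimep_expr; rewrite coprimep_XsubC. Qed.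

Lemma coprimep_ends_inner s m i j :
  coprimep (('X - a%:P) ^+ i * ('X - b%:P) ^+ j) (inner_poly s m).
Proof.
rewrite coprimepMl !(coprimep_sym _ (inner_poly s m)).
by rewrite !coprimep_inner_end // in_itv /= ltxx // andbF.
Qed.

Lemma dvdp_nodal s m p : (nodal s m %| p) =
  [&& ('X - a%:P) ^+ uphalf m %| p, ('X - b%:P) ^+ m./2.+1 %| p & inner_poly s m %| p].
Proof. by rewrite !Gauss_dvdp ?coprimep_ends ?coprimep_ends_inner // andbA. Qed.

Lemma vanishes_nodal s m p : vanishes_at_nodes s m a b p <-> nodal s m %| p.
Proof.
rewrite dvdp_nodal; split=> [[-> ->]|/and3P[ha hb /dvdp_inner_polyP]] //=.
by move/dvdp_inner_polyP.
Qed.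

Lemma size_nodal s m : (m <= s)%N -> size (nodal s m) = s.+2.
Proof.
move=> ms; have e0 c i : ('X - c%:P) ^+ i != 0 :> {poly R} by rewrite expf_neq0 ?polyXsubC_eq0.
rewrite /nodal !size_mul ?mulf_neq0 ?inner_poly_neq0 //.
rewrite !size_exp_XsubC size_inner_poly; lia.
Qed.

Lemma nodal_neq0 s m : nodal s m != 0.
Proof. by rewrite !mulf_neq0 ?inner_poly_neq0 ?expf_neq0 ?polyXsubC_eq0. Qed.

(** The Jacobi weight supplies exactly the end point factors of the nodal
    polynomial; this is what raises the exactness of the quadrature. *)
Lemma nodal_orthogonal s m p : (size p <= s - m)%N -> pint a b (nodal s m * p) = 0.
Proof.
move=> sp; rewrite pint_from_ref //.
set c := (b - a) / 2.
have -> : nodal s m * p \Po from_poly a b = (c ^+ uphalf m * (- c) ^+ m./2.+1) *: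
    ((1 + 'X) ^+ uphalf m * (1 - 'X) ^+ m./2.+1 * ref_node_poly s m * (p \Po from_poly a b)).
  rewrite !comp_polyM inner_poly_from !rmorphXn /= !comp_polyB !comp_polyX !comp_polyC.
  have -> : from_poly a b - a%:P = c%:P * (1 + 'X).
    rewrite /from_poly mulrDr mulr1 [RHS]addrC -addrA -polyCB; congr (_ + _%:P).
    by rewrite /c; field.
  have -> : from_poly a b - b%:P = (- c)%:P * (1 - 'X).
    rewrite /from_poly mulrBr mulr1 polyCN mulNr opprK [RHS]addrC -addrA -polyCB.
    by rewrite -polyCN; congr (_ + _%:P); rewrite /c; field.
  by clearbody c; rewrite !exprMn -mul_polyC polyCM !polyC_exp; ring.
by rewrite pintZ jacobi_orthogonal ?mulr0 // size_comp_from.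
Qed.

(** Up to sign the integrand is nonnegative on the interval. *)
Lemma pint_ends_sqr_neq0 i j Z : Z != 0 ->
  pint a b (('X - a%:P) ^+ i * ('X - b%:P) ^+ j * Z * Z) != 0.
Proof.
move=> Z0.
suff : 0 < pint a b (((-1) ^+ j) *: (('X - a%:P) ^+ i * ('X - b%:P) ^+ j * Z * Z)).
  by rewrite pintZ; apply: contraTneq => ->; rewrite mulr0 ltxx.
apply: pint_gt0 => // [x|]; last first.
  by rewrite scaler_eq0 expf_eq0 oppr_eq0 oner_eq0 andbF /= !mulf_neq0 ?expf_neq0 ?polyXsubC_eq0.
rewrite in_itv /= => /andP[ax xb].
rewrite hornerZ !hornerM !horner_exp !hornerXsubC -!mulrA.
rewrite mulrCA [(-1) ^+ j * _]mulrA -exprMn mulN1r opprB.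
apply: mulr_ge0; first by rewrite exprn_ge0 // subr_ge0 ltW.
by apply: mulr_ge0; [rewrite exprn_ge0 // subr_ge0 ltW|rewrite -expr2 sqr_ge0].
Qed.

End OneInterval.
End Nodes.

(** * Hermite interpolation and quadrature by reduction modulo the nodal polynomial *)

Section Interpolation.
Context {R : realType}.
Implicit Types (p q G H : {poly R}) (g h : R -> R) (s m n i j : nat).

Lemma at_right_itvoo (a b : R) : a < b -> a^'+ [set` `]a, b[].
Proof.
move=> ab; near=> x; rewrite /= in_itv /=; apply/andP; split.
  by near: x; exact: nbhs_right_gt.
by near: x; exact: nbhs_right_lt.
Unshelve. all: by end_near. Qed.

Lemma at_left_itvoo (a b : R) : a < b -> b^'- [set` `]a, b[].
Proof.
move=> ab; near=> x; rewrite /= in_itv /=; apply/andP; split.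
  by near: x; exact: nbhs_left_gt.
by near: x; exact: nbhs_left_lt.
Unshelve. all: by end_near. Qed.

Lemma at_right_cvg (a : R) : a^'+ --> a.
Proof. exact: cvg_within. Qed.

Lemma at_left_cvg (a : R) : a^'- --> a.
Proof. exact: cvg_within. Qed.

Definition contact_right (a b : R) n g G := contact (a^'+) a a b n g G.
Definition contact_left (a b : R) n g G := contact (b^'-) b a b n g G.

Lemma contact_right_dright a b n g G j : contact_right a b n g G -> (j < n)%N ->
  dright g j a = (G^`(j)).[a].
Proof. exact: contact_lim. Qed.

Lemma contact_left_dleft a b n g G j : contact_left a b n g G -> (j < n)%N ->
  dleft g j b = (G^`(j)).[b].
Proof. exact: contact_lim. Qed.

Lemma horner_from_fun a b : horner (from_poly a b) = from_ref a b :> (R -> R).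
Proof. by apply/funext => x; rewrite horner_from. Qed.

Lemma from_ref1 (a b : R) : from_ref a b 1 = b.
Proof. by rewrite /from_ref; field. Qed.

Lemma from_refN1 (a b : R) : from_ref a b (-1) = a.
Proof. by rewrite /from_ref; field. Qed.

Section OneInterval.
Variables (a b : R).
Hypothesis ab : a < b.

(** The affine map preserves the side from which the end point is approached. *)
Lemma from_ref_at_right : (from_poly a b).[x] @[x --> (-1)^'+] --> a^'+.
Proof.
move=> A; rewrite /at_right /within /= => hA.
have := @continuous_horner _ (from_poly a b) (-1) [set u | a < u -> A u].
rewrite /= horner_from from_refN1 => /(_ hA) hn.
change (nbhs (-1 : R) (fun x => -1 < x -> A (from_poly a b).[x])).
apply: (@filterS _ (nbhs (-1 : R)) _ _ _ _ hn) => x /= h x1; apply: h.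
rewrite horner_from /from_ref.
have : 0 < (b - a) * (1 + x) by rewrite mulr_gt0 ?subr_gt0 //; lra.
lra.
Qed.

Lemma from_ref_at_left : (from_poly a b).[x] @[x --> 1^'-] --> b^'-.
Proof.
move=> A; rewrite /at_left /within /= => hA.
have := @continuous_horner _ (from_poly a b) 1 [set u | u < b -> A u].
rewrite /= horner_from from_ref1 => /(_ hA) hn.
change (nbhs (1 : R) (fun x => x < 1 -> A (from_poly a b).[x])).
apply: (@filterS _ (nbhs (1 : R)) _ _ _ _ hn) => x /= h x1; apply: h.
rewrite horner_from /from_ref.
have : 0 < (b - a) * (1 - x) by rewrite mulr_gt0 ?subr_gt0.
lra.
Qed.

Lemma contact_right_from n g G : contact_right a b n g G ->
  contact_right (-1) 1 n (g \o from_ref a b) (G \Po from_poly a b).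
Proof.
rewrite -horner_from_fun => h.
apply: contact_comp from_ref_at_right h => //.
- by apply: at_right_itvoo; rewrite gtrN.
- exact: at_right_cvg.
- by rewrite horner_from from_refN1.
- by move=> x xI; rewrite horner_from; exact: from_ref_itv.
Qed.

Lemma contact_left_from n g G : contact_left a b n g G ->
  contact_left (-1) 1 n (g \o from_ref a b) (G \Po from_poly a b).
Proof.
rewrite -horner_from_fun => h.
apply: contact_comp from_ref_at_left h => //.
- by apply: at_left_itvoo; rewrite gtrN.
- exact: at_left_cvg.
- by rewrite horner_from from_ref1.
- by move=> x xI; rewrite horner_from; exact: from_ref_itv.
Qed.

(** [G] has the data of [g] that the interpolation operator reads. Quadrature of
    [g] then only depends on [G]. *)
Definition contact_nodes s m g G : Prop :=
  [/\ contact_right a b (uphalf m) g G, contact_left a b m./2.+1 g G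
    & forall x, root (ref_node_poly s m) x -> g (from_ref a b x) = G.[from_ref a b x]].

Lemma contact_nodesD s m g G h H : contact_nodes s m g G -> contact_nodes s m h H ->
  contact_nodes s m (fun x => g x + h x) (G + H).
Proof.
move=> [gr gl gi] [hr hl hi]; split=> [||x rx].
- exact: contactD (at_right_itvoo ab) _ _ _ _ _ gr hr.
- exact: contactD (at_left_itvoo ab) _ _ _ _ _ gl hl.
- by rewrite hornerD gi // hi.
Qed.

Lemma contact_nodesM s m g G h H : contact_nodes s m g G -> contact_nodes s m h H ->
  contact_nodes s m (fun x => g x * h x) (G * H).
Proof.
move=> [gr gl gi] [hr hl hi]; split=> [||x rx].
- exact: contactM (at_right_itvoo ab) _ _ _ _ _ gr hr.
- exact: contactM (at_left_itvoo ab) _ _ _ _ _ gl hl.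
- by rewrite hornerM gi // hi.
Qed.

Lemma contact_nodes_horner s m G : contact_nodes s m (horner G) G.
Proof.
split=> //; apply: contact_horner;
  [exact: at_right_cvg|exact: at_left_cvg].
Qed.

Lemma contact_nodes_eq s m g h G : {in `]a, b[, g =1 h} ->
  contact_nodes s m g G -> contact_nodes s m h G.
Proof.
move=> gh [gr gl gi]; split.
- exact: contact_eq_itv (at_right_itvoo ab) _ _ _ _ gh gr.
- exact: contact_eq_itv (at_left_itvoo ab) _ _ _ _ gh gl.
- by move=> x rx; rewrite -gh ?gi // from_ref_itv // (root_ref_node_poly rx).
Qed.

Lemma contact_nodes_poly s m g G : {in `]a, b[, g =1 horner G} -> contact_nodes s m g G.
Proof.
by move=> gG; apply: contact_nodes_eq (contact_nodes_horner s m G) => x /gG.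
Qed.

Lemma contact_dvdp F c n g G H : ('X - c%:P) ^+ n %| G - H ->
  contact F c a b n g G -> contact F c a b n g H.
Proof.
move=> /dvdp_XsubC_expP GH; apply: contact_eq_poly => j /GH.
by rewrite derivnB hornerD hornerN => /eqP; rewrite subr_eq0 => /eqP.
Qed.

Lemma contact_nodes_dvdp s m g G H : nodal a b s m %| G - H ->
  contact_nodes s m g G -> contact_nodes s m g H.
Proof.
rewrite dvdp_nodal // => /and3P[ha hb /(dvdp_inner_polyP ab) hi] [gr gl gi].
split; [exact: contact_dvdp gr|exact: contact_dvdp gl|move=> x rx].
have /eqP := hi _ rx; rewrite gi // hornerD hornerN => /eqP.
by rewrite subr_eq0 => /eqP.
Qed.

Lemma ref_interp_unique s m g p q : (m <= s)%N ->
  is_ref_interp s m g p -> is_ref_interp s m g q -> p = q.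
Proof.
move=> ms [sp pr pl pi] [sq qr ql qi]; apply/eqP; rewrite -subr_eq0.
have lt11 : -1 < 1 :> R by rewrite gtrN.
suff : nodal (-1) 1 s m %| p - q.
  apply: contraTT => /dvdp_leq le; apply/negP => /le.
  rewrite size_nodal // leqNgt ltnS (leq_trans (size_polyD _ _)) //.
  by rewrite size_polyN geq_max sp.
rewrite dvdp_nodal //; apply/and3P; split.
- by apply/dvdp_XsubC_expP => j jm; rewrite derivnB hornerD hornerN pr // qr // subrr.
- by apply/dvdp_XsubC_expP => j jm; rewrite derivnB hornerD hornerN pl // ql // subrr.
- apply/(dvdp_inner_polyP lt11) => x rx; rewrite (_ : from_ref _ _ x = x).
    by rewrite /root hornerD hornerN pi // qi // subrr.
  by rewrite /from_ref; field.
Qed.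

(** The remainder has the node data of [G] and the degree of an interpolant, and
    Hermite interpolation is unique. *)
Lemma interp_contact s m g G x : (m <= s)%N -> contact_nodes s m g G ->
  interp s m a b g x = (G %% nodal a b s m).[x].
Proof.
move=> ms hG; have {hG} := @contact_nodes_dvdp s m g G (G %% nodal a b s m) _ hG.
set H := G %% _ => /(_ _)[|hr hl hi].
  by rewrite {1}(divp_eq G (nodal a b s m)) addrK dvdp_mull.
have sH : (size H <= s.+1)%N by rewrite -ltnS -(size_nodal ab ms) ltn_modp nodal_neq0.
have hp : is_ref_interp s m (g \o from_ref a b) (H \Po from_poly a b).
  split=> [|j jm|j jm|y ry].
  - by rewrite size_comp_from.
  - by rewrite (contact_right_dright (contact_right_from hr)).
  - by rewrite (contact_left_dleft (contact_left_from hl)).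
  - by rewrite horner_comp horner_from /= hi.
have hr' : is_ref_interp s m (g \o from_ref a b) (ref_interp s m (g \o from_ref a b)).
  by apply: xgetPex; exists (H \Po from_poly a b).
by rewrite /interp (ref_interp_unique ms hr' hp) horner_comp horner_from from_toK.
Qed.

Lemma quad_contact s m g G : (m <= s)%N -> contact_nodes s m g G ->
  quad s m a b g = pint a b (G %% nodal a b s m).
Proof.
move=> ms hG; rewrite -Rintegral_horner //; congr Rintegral.
by apply/funext => x; exact: interp_contact.
Qed.

(** The quotient of [G] by the nodal polynomial has degree below [s - m], to
    which the nodal polynomial is orthogonal. *)
Lemma quad_exact s m G : (m <= s)%N -> (size G <= s.+1 + (s - m))%N ->
  pint a b (G %% nodal a b s m) = pint a b G.
Proof.
move=> ms sG; rewrite {2}(divp_eq G (nodal a b s m)) pintD mulrC.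
by rewrite nodal_orthogonal // ?add0r // size_divp ?nodal_neq0 // size_nodal //= leq_subLR.
Qed.

(** Taylor polynomials at both ends and the Lagrange polynomial of the interior
    nodes are glued by the Chinese remainder theorem. *)
Lemma contact_nodes_exists s m K A B g : (m <= s)%N -> (m./2 <= K)%N ->
  A <= a -> b <= B -> smooth_on K A B g ->
  exists2 G : {poly R}, (size G <= s.+1)%N & contact_nodes s m g G.
Proof.
move=> ms mK Aa bB [_ dg cg lg].
have sub x : x \in `]a, b[ -> x \in `]A, B[.
  by rewrite !in_itv /= => /andP[ax xb]; rewrite (le_lt_trans Aa ax) (lt_le_trans xb bB).
have jK n j : (n <= m./2.+1)%N -> (j < n)%N -> (j <= K)%N.
  by move=> h1 h2; rewrite (leq_trans _ mK) // -ltnS (leq_trans h2).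
have qm : (uphalf m <= m./2.+1)%N by rewrite uphalf_half; case: (odd m); lia.
have [Ga hGa] : exists G, contact_right a b (uphalf m) g G.
  apply: contact_exists => [j jm|j x jm xI]; last first.
    by apply: dg (sub _ xI); apply: jK qm _.
  have jle := jK _ _ qm jm.
  move: Aa; rewrite le_eqVlt => /predU1P[<-|Aa]; first by have [] := lg _ jle.
  apply: cvgP; apply: cvg_at_right_filter; apply: cg jle _.
  by rewrite in_itv /= Aa (lt_le_trans ab).
have [Gb hGb] : exists G, contact_left a b m./2.+1 g G.
  apply: contact_exists => [j jm|j x jm xI]; last first.
    by apply: dg (sub _ xI); apply: jK (leqnn _) _.
  have jle := jK _ _ (leqnn _) jm.
  move: bB; rewrite le_eqVlt => /predU1P[->|bB]; first by have [] := lg _ jle.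
  apply: cvgP; apply: cvg_at_left_filter; apply: cg jle _.
  by rewrite in_itv /= bB (le_lt_trans Aa).
have [xs [uxs _ _ xsE]] := @ref_node_poly_roots R s m.
have [Gi hGi] := lagrange_exists (g \o from_ref a b) uxs.
have [G1 G1a G1b] := chinese_poly Ga Gb (coprimep_ends ab (uphalf m) m./2.+1).
have [G G_1 G_i] := chinese_poly G1 (Gi \Po to_poly a b)
  (coprimep_ends_inner ab s m (uphalf m) m./2.+1).
exists (G %% nodal a b s m).
  by rewrite -ltnS -(size_nodal ab ms) ltn_modp nodal_neq0.
apply: (@contact_nodes_dvdp _ _ _ G).
  by rewrite {1}(divp_eq G (nodal a b s m)) addrK dvdp_mull.
split.
- apply: contact_dvdp hGa; rewrite -dvdpNr opprB.
  rewrite (_ : G - Ga = (G - G1) + (G1 - Ga)); last by rewrite addrA subrK.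
  by rewrite dvdp_addl // (dvdp_trans _ G_1) // dvdp_mulr.
- apply: contact_dvdp hGb; rewrite -dvdpNr opprB.
  rewrite (_ : G - Gb = (G - G1) + (G1 - Gb)); last by rewrite addrA subrK.
  by rewrite dvdp_addl // (dvdp_trans _ G_1) // dvdp_mull.
- move=> x rx; have /(dvdp_inner_polyP ab) /(_ x rx) := G_i.
  rewrite /root hornerD hornerN subr_eq0 => /eqP->.
  rewrite horner_comp horner_to to_fromK // hGi //.
  by rewrite -root_prod_XsubC -xsE.
Qed.

End OneInterval.
End Interpolation.

(** * The corrected residual on one interval *)

Section Postprocessing.
Context {R : realType}.
Variables (a b : R) (r k : nat).
Hypotheses (ab : a < b) (hkr : (k < r)%N).
Implicit Types (p phi sg th : {poly R}).

Local Notation w := (inner_poly a b r k).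
Local Notation om := (nodal a b r k).
Local Notation Q p := (pint a b (p %% om)).

Let kr : (k <= r)%N := ltnW hkr.

(** [E = (X - a)^i (X - b)^j] lacks one factor [X - c] of the end point part of
    the nodal polynomial. Modulo the latter [E sg w] is [sg.[c] E w], and the
    integral of [E w] is not zero: writing [w = w.[c] + (X - c) v] and using
    orthogonality of the nodal polynomial to [v], it equals the integral of
    [E w^2], of constant sign, divided by [w.[c]]. *)
Lemma deficient_end_factor c i j sg :
  ('X - c%:P) * (('X - a%:P) ^+ i * ('X - b%:P) ^+ j) =
    ('X - a%:P) ^+ uphalf k * ('X - b%:P) ^+ k./2.+1 ->
  Q (('X - a%:P) ^+ i * ('X - b%:P) ^+ j * sg * w) = 0 -> root sg c.
Proof.
set E := _ ^+ i * _ => hE hQ.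
have omE : om = ('X - c%:P) * E * w by rewrite /nodal -hE.
have split_c p : exists2 v, p = v * ('X - c%:P) + p.[c]%:P &
    (size v <= (size p).-1)%N.
  have /factor_theorem[v hv] : root (p - p.[c]%:P) c.
    by rewrite /root hornerD hornerN hornerC subrr.
  exists v; first by rewrite -hv subrK.
  have [->|v0] := eqVneq v 0; first by rewrite size_poly0.
  have : (size (p - p.[c]%:P)%R <= size p)%N.
    have [->|p0] := eqVneq p 0; first by rewrite horner0 subrr.
    rewrite (leq_trans (size_polyD _ _)) // geq_max leqnn size_polyN.
    by rewrite (leq_trans (size_polyC_leq1 _)) // size_poly_gt0.
  by rewrite hv size_mul ?polyXsubC_eq0 // size_XsubC addn2 /=; case: (size p).
have w0 : w != 0 by rewrite inner_poly_neq0.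
have Ew_neq0 : pint a b (E * w) != 0.
  have := pint_ends_sqr_neq0 ab i j w0; rewrite -/E; apply: contraNneq => Ew.
  have [v wv sv] := split_c w.
  rewrite {2}wv mulrDr pintD (mulrC v) mulrA (_ : E * w * _ = om); last first.
    by rewrite omE; ring.
  rewrite nodal_orthogonal //; last by move: sv; rewrite size_inner_poly.
  by rewrite add0r mulrC mul_polyC pintZ Ew mulr0.
have [v sgv _] := split_c sg.
move: hQ; rewrite sgv.
have -> : E * (v * ('X - c%:P) + sg.[c]%:P) * w = v * om + sg.[c] *: (E * w).
  by rewrite omE -mul_polyC; ring.
rewrite modpD modp_mull add0r modpZl modp_small; last first.
  have E0 : E != 0 by rewrite mulf_neq0 // expf_neq0 // polyXsubC_eq0.
  have Ew0 : E * w != 0 by rewrite mulf_neq0.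
  by rewrite omE -mulrA [ltnRHS]size_mul ?polyXsubC_eq0 // size_XsubC add2n.
by rewrite pintZ => /eqP; rewrite mulf_eq0 (negPf Ew_neq0) orbF -sgv.
Qed.

Lemma size_polyM_le p phi m n : (size p <= m.+1)%N -> (size phi <= n)%N ->
  (size (p * phi)%R <= m + n)%N.
Proof.
move=> sp sphi; rewrite (leq_trans (size_polyMleq _ _)) // -subn1 leq_subLR.
by rewrite add1n -addSn leq_add.
Qed.

(** One component of the situation on an interval: [rho] is the residual of the
    uncorrected solution, [th] the correction polynomial, [c1] and [c2] the
    components of [M c] and [A c], and [J] that of [M] times the jump at [a]. *)
Section Residual.
Variables (rho th : {poly R}) (c1 c2 J : R).
Hypothesis size_rho : (size rho <= r.+2)%N.
Hypothesis rho_test : forall phi, (size phi <= (r - k).+1)%N ->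
  Q (rho * phi) + (k == 0%N)%:R * (J * phi.[a]) = 0.
Hypothesis rho_a : ('X - a%:P) ^+ (uphalf k).-1 %| rho.
Hypothesis rho_b : ('X - b%:P) ^+ k./2 %| rho.
Hypotheses (size_th : (size th <= r.+2)%N) (om_th : om %| th).

Definition corrected : {poly R} := rho + c1 *: th^`() + c2 *: th.

Lemma th_orthogonal phi : (size phi <= r - k)%N -> pint a b (th * phi) = 0.
Proof.
move=> sphi; have /dvdpP[u thu] := om_th.
have /size1_polyC uC : (size u <= 1)%N.
  have [->|u0] := eqVneq u 0; first by rewrite size_poly0.
  by move: size_th; rewrite thu size_mul ?nodal_neq0 // size_nodal // addnS /=
    -[r.+2]add1n leq_add2r.
by rewrite thu uC -mulrA mul_polyC pintZ nodal_orthogonal ?mulr0.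
Qed.

Lemma th_a j : (j < uphalf k)%N -> (th^`(j)).[a] = 0.
Proof. by move: om_th; rewrite dvdp_nodal // => /and3P[/dvdp_XsubC_expP h _ _] /h. Qed.

Lemma th_b j : (j < k./2.+1)%N -> (th^`(j)).[b] = 0.
Proof. by move: om_th; rewrite dvdp_nodal // => /and3P[_ /dvdp_XsubC_expP h _] /h. Qed.

Lemma size_deriv_th : (size th^`() <= r.+1)%N.
Proof.
have [->|t0] := eqVneq th 0; first by rewrite derivC size_poly0.
by rewrite -ltnS (leq_trans (lt_size_deriv t0)).
Qed.

Lemma pint_deriv_th phi : (size phi <= (r - k).+1)%N ->
  pint a b (th^`() * phi) = - ((k == 0%N)%:R * (th.[a] * phi.[a])).
Proof.
move=> sphi; rewrite pint_parts th_orthogonal; last first.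
  have [->|p0] := eqVneq phi 0; first by rewrite derivC size_poly0.
  by rewrite -ltnS (leq_trans (lt_size_deriv p0)).
have -> : th.[b] = 0 by have := th_b (ltn0Sn _); rewrite derivn0.
rewrite mul0r sub0r subr0; case: eqVneq => [_|k0]; first by rewrite mul1r.
have -> : th.[a] = 0; last by rewrite !mul0r.
by have := @th_a 0; rewrite derivn0; apply; case: (k) k0.
Qed.

(** The correction changes the tested residual only through the jump: the rule
    is exact on th' phi, and integration by parts leaves the value at a. *)
Lemma corrected_test phi : (size phi <= (r - k).+1)%N ->
  Q (corrected * phi) = - ((k == 0%N)%:R * ((J + c1 * th.[a]) * phi.[a])).
Proof.
move=> sphi; rewrite /corrected.
have -> : (rho + c1 *: th^`() + c2 *: th) * phi =
    rho * phi + c1 *: (th^`() * phi) + c2 *: (th * phi) by rewrite -!mul_polyC; ring.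
rewrite !modpD !modpZl !pintD !pintZ.
have -> : (th * phi) %% om = 0 by apply/eqP; exact: dvdp_mulr.
rewrite pint0 mulr0 addr0 [Q (th^`() * phi)](quad_exact ab kr); last first.
  by rewrite addSnnS; exact: size_polyM_le size_deriv_th sphi.
rewrite pint_deriv_th // -[Q _](addrK ((k == 0%N)%:R * (J * phi.[a]))) rho_test //.
ring.
Qed.

Lemma size_corrected : (size corrected <= r.+2)%N.
Proof.
rewrite /corrected !(leq_trans (size_polyD _ _)) // geq_max.
rewrite (leq_trans (size_scale_leq _ _)) // andbT.
rewrite (leq_trans (size_polyD _ _)) // geq_max size_rho.
by rewrite (leq_trans (size_scale_leq _ _)) // (leq_trans size_deriv_th).
Qed.

Lemma pint_corrected phi : (size phi <= r - k)%N ->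
  pint a b (corrected * phi) = - ((k == 0%N)%:R * ((J + c1 * th.[a]) * phi.[a])).
Proof.
move=> sphi; rewrite -corrected_test ?leqW // (quad_exact ab kr) //.
exact: size_polyM_le size_corrected sphi.
Qed.

Lemma corrected_derivn j c : ((corrected)^`(j)).[c] =
  (rho^`(j)).[c] + c1 * (th^`(j.+1)).[c] + c2 * (th^`(j)).[c].
Proof. by rewrite !derivnD !derivnZ !hornerD !hornerZ derivSn. Qed.

Lemma corrected_a : ('X - a%:P) ^+ (uphalf k).-1 %| corrected.
Proof.
apply/dvdp_XsubC_expP => j jk; rewrite corrected_derivn.
have := rho_a; move/dvdp_XsubC_expP => -> //.
have jk' : (j.+1 < uphalf k)%N by move: jk; case: uphalf.
by rewrite !th_a ?mulr0 ?addr0 // ltnW.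
Qed.

Lemma corrected_b : ('X - b%:P) ^+ k./2 %| corrected.
Proof.
apply/dvdp_XsubC_expP => j jk; rewrite corrected_derivn.
have := rho_b; move/dvdp_XsubC_expP => -> //.
by rewrite !th_b ?mulr0 ?addr0 // ltnW.
Qed.

(** The test polynomial [w] kills the interior nodes, so that the tested residual
    only sees the two end points; see [deficient_end_factor]. *)
Lemma corrected_a_of_b : (0 < k)%N -> ('X - b%:P) ^+ k./2.+1 %| corrected ->
  ('X - a%:P) ^+ uphalf k %| corrected.
Proof.
move=> k0 hb; have q0 : (0 < uphalf k)%N by case: (k) k0.
have : ('X - a%:P) ^+ (uphalf k).-1 * ('X - b%:P) ^+ k./2.+1 %| corrected.
  by rewrite Gauss_dvdp ?corrected_a ?coprimep_ends.
move=> /dvdpP[sg]; rewrite mulrC => hsg.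
have : root sg a.
  apply: (@deficient_end_factor _ (uphalf k).-1 k./2.+1).
    by rewrite mulrA -exprS prednK.
  rewrite -hsg corrected_test ?size_inner_poly //.
  by rewrite gtn_eqF // mul0r oppr0.
move=> /factor_theorem[v sgv]; rewrite hsg sgv.
rewrite -{1}(prednK q0) exprSr.
by apply/dvdpP; exists (v * ('X - b%:P) ^+ k./2.+1); ring.
Qed.

(** For [k = 0] the nodal polynomial is [(X - b) w], and the test by [w] leaves
    nothing but the jump term, while [w.[a]] is not zero. *)
Lemma jump_of_b : k = 0%N -> ('X - b%:P) ^+ k./2.+1 %| corrected ->
  J + c1 * th.[a] = 0.
Proof.
move=> k0 /dvdpP[sg hsg].
have := @corrected_test w; rewrite size_inner_poly // => /(_ (leqnn _)).
have -> : (corrected * w) %% om = 0.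
  apply/eqP; rewrite -/(_ %| _) hsg -mulrA; apply: dvdp_mull.
  by rewrite /nodal k0 expr0 mul1r.
rewrite pint0 (introT eqP k0) mul1r => /esym /eqP; rewrite oppr_eq0 mulf_eq0.
have /negPf : ~~ root w a by rewrite inner_poly_end // in_itv /= ltxx.
by rewrite /root => ->; rewrite orbF => /eqP.
Qed.

Lemma corrected_b_of_a : (k = 0%N -> J + c1 * th.[a] = 0) ->
  ('X - a%:P) ^+ uphalf k %| corrected -> ('X - b%:P) ^+ k./2.+1 %| corrected.
Proof.
move=> hJ ha.
have : ('X - a%:P) ^+ uphalf k * ('X - b%:P) ^+ k./2 %| corrected.
  by rewrite Gauss_dvdp ?corrected_b ?coprimep_ends // ha.
move=> /dvdpP[sg]; rewrite mulrC => hsg.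
have : root sg b.
  apply: (@deficient_end_factor _ (uphalf k) k./2); first by rewrite mulrCA -exprS.
  rewrite -hsg corrected_test ?size_inner_poly //.
  by case: eqVneq => [/hJ->|_]; rewrite !mul0r ?mulr0 oppr0.
move=> /factor_theorem[v sgv]; rewrite hsg sgv exprSr.
by apply/dvdpP; exists (v * ('X - a%:P) ^+ uphalf k); ring.
Qed.

End Residual.
End Postprocessing.

(** * Existence of the correction polynomials *)

Section Theta.
Context {R : realType}.
Variables (a b : R) (r k : nat).
Hypotheses (ab : a < b) (kr : (k <= r)%N).

(** The nodal polynomial, scaled. *)
Lemma theta_exists c n (u : {poly R}) : nodal a b r k = ('X - c%:P) ^+ n * u ->
  ~~ root u c -> exists th : {poly R}, [/\ (size th <= r.+2)%N, vanishes_at_nodes r k a b th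
    & (th^`(n)).[c] = 1].
Proof.
move=> omE uc; exists ((n`!%:R * u.[c])^-1 *: nodal a b r k); split.
- by rewrite (leq_trans (size_scale_leq _ _)) // size_nodal.
- by apply/vanishes_nodal => //; rewrite -mul_polyC dvdp_mull.
- rewrite derivnZ hornerZ omE derivn_XsubC_exp_lead mulVf // mulf_neq0 //.
Qed.

Lemma theta_resP : is_theta_res r k a b (theta_res r k a b).
Proof.
apply: xgetPex; apply: (@theta_exists b k./2.+1 (('X - a%:P) ^+ uphalf k * inner_poly a b r k)).
  by rewrite /nodal; ring.
rewrite rootM negb_or inner_poly_end ?andbT //; last by rewrite in_itv /= ltxx andbF.
by rewrite /root horner_exp hornerXsubC expf_neq0 // subr_eq0 gt_eqF.
Qed.

Lemma theta_jumpP : is_theta_jump r k a b (theta_jump r k a b).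
Proof.
apply: xgetPex; apply: (@theta_exists a (uphalf k) (('X - b%:P) ^+ k./2.+1 * inner_poly a b r k)).
  by rewrite /nodal mulrA.
rewrite rootM negb_or inner_poly_end ?andbT //; last by rewrite in_itv /= ltxx.
by rewrite /root horner_exp hornerXsubC expf_neq0 // subr_eq0 lt_eqF.
Qed.

End Theta.

(** * Vector-valued polynomials *)

Section VectorPolynomials.
Context {R : realType} {d : nat}.
Implicit Types (p F phi : 'cV[{poly R}]_d) (V g : R -> 'cV[R]_d) (M A : 'M[R]_d).

Definition vder p (j : nat) (x : R) : 'cV[R]_d := \col_i ((p i 0)^`(j)).[x].

Definition vresid M A p F : 'cV[{poly R}]_d :=
  \col_i (\sum_j M i j *: (p j 0)^`() + \sum_j A i j *: p j 0 - F i 0).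

Lemma vder_vresid M A p F j x :
  vder (vresid M A p F) j x = M *m vder p j.+1 x + A *m vder p j x - vder F j x.
Proof.
apply/colP => i; rewrite !mxE derivnB derivnD !(linear_sum (derivn j)).
rewrite hornerD hornerN hornerD !horner_sum.
congr (_ + _ - _); apply: eq_bigr => l _; rewrite /= derivnZ hornerZ !mxE //.
by rewrite -derivSn.
Qed.

Lemma size_vresid M A p F s i : vpoly_deg s p -> vpoly_deg s F ->
  (size (vresid M A p F i 0%R) <= s.+1)%N.
Proof.
move=> sp sF; rewrite mxE; apply: (leq_trans (size_polyD _ _)).
rewrite size_polyN geq_max sF andbT; apply: (leq_trans (size_polyD _ _)).
rewrite geq_max; apply/andP; split; apply: (leq_trans (size_sum _ _ _));
  apply/bigmax_leqP => j _; apply: (leq_trans (size_scale_leq _ _)) => //.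
have [->|p0] := eqVneq (p j 0) 0; first by rewrite derivC size_poly0.
by apply: leq_trans (ltnW (lt_size_deriv p0)) _.
Qed.

Section OneInterval.
Variables (a b : R).
Hypothesis ab : a < b.

Lemma contact_nodes_sum s m (I : Type) (l : seq I) (g : I -> R -> R) (G : I -> {poly R}) :
  (forall i, contact_nodes a b s m (g i) (G i)) ->
  contact_nodes a b s m (fun x => \sum_(i <- l) g i x) (\sum_(i <- l) G i).
Proof.
move=> h; elim: l => [|i l IH].
  by apply: contact_nodes_poly => // x _; rewrite !big_nil horner0.
rewrite big_cons; apply: (contact_nodes_eq ab _ (contact_nodesD ab (h i) IH)) => x _.
by rewrite big_cons.
Qed.

Lemma contact_right_poly n (g : R -> R) (G : {poly R}) :
  {in `]a, b[, g =1 horner G} -> contact_right a b n g G.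
Proof.
move=> gG; apply: (contact_eq_itv (at_right_itvoo ab) (g := horner G)).
  by move=> x /gG.
by apply: contact_horner; exact: at_right_cvg.
Qed.

Lemma contact_left_poly n (g : R -> R) (G : {poly R}) :
  {in `]a, b[, g =1 horner G} -> contact_left a b n g G.
Proof.
move=> gG; apply: (contact_eq_itv (at_left_itvoo ab) (g := horner G)).
  by move=> x /gG.
by apply: contact_horner; exact: at_left_cvg.
Qed.

Variables (V : R -> 'cV[R]_d) (p : 'cV[{poly R}]_d).
Hypothesis Vp : forall x, x \in `]a, b] -> V x = vhorner p x.

Let Vpi i : {in `]a, b[, (fun x => V x i 0) =1 horner (p i 0)}.
Proof.
move=> x; rewrite in_itv /= => /andP[ax xb].
by rewrite Vp ?mxE // in_itv /= ax ltW.
Qed.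

Lemma vdright_poly j : vdright V j a = vder p j a.
Proof.
apply/colP => i; rewrite !mxE.
exact: (contact_right_dright (contact_right_poly j.+1 (Vpi i))).
Qed.

Lemma vdleft_poly j : vdleft V j b = vder p j b.
Proof.
apply/colP => i; rewrite !mxE.
exact: (contact_left_dleft (contact_left_poly j.+1 (Vpi i))).
Qed.

Lemma vderive_poly x : x \in `]a, b[ -> vderive V x = vder p 1 x.
Proof.
move=> xI; apply/colP => i; rewrite !mxE derivn1 derivE.
exact: (derive1_itvoo_eq (Vpi i)).
Qed.

(** The two sides of the variational equation differ by the tested residual,
    reduced modulo the nodal polynomial. *)
Lemma quad_vresid M A s m g F phi : (m <= s)%N ->
  (forall i, contact_nodes a b s m (fun x => g x i 0) (F i 0)) ->
  quad s m a b (fun x => dot (M *m vderive V x) (vhorner phi x)) -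
    quad s m a b (fun x => dot (g x - A *m V x) (vhorner phi x)) =
  \sum_i pint a b ((vresid M A p F i 0 * phi i 0) %% nodal a b s m).
Proof.
move=> ms gF.
pose P1 := \sum_i (\sum_j M i j *: (p j 0)^`()) * phi i 0.
pose P2 := \sum_i (F i 0 - \sum_j A i j *: p j 0) * phi i 0.
rewrite (quad_contact ab ms (G := P1)); last first.
  apply: contact_nodes_poly => // x xI; rewrite vderive_poly // /dot horner_sum.
  apply: eq_bigr => i _; rewrite hornerM !mxE horner_sum; congr (_ * _).
  by apply: eq_bigr => j _; rewrite hornerZ mxE derivn1.
rewrite (quad_contact ab ms (G := P2)); last first.
  apply: contact_nodes_sum => i; apply: contact_nodesM => //; last first.
    by apply: contact_nodes_poly => // x _; rewrite mxE.
  apply: (contact_nodes_eq ab (g := fun x => g x i 0 + (- \sum_j A i j *: p j 0).[x])).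
    move=> x xI; rewrite !mxE hornerN horner_sum; congr (_ - _).
    by apply: eq_bigr => j _; rewrite hornerZ Vpi.
  by apply: contact_nodesD => //; exact: contact_nodes_horner.
rewrite -pintB -modpN -modpD /P1 /P2 -sumrB.
elim/big_rec2: _ => [|i y z _ <-]; first by rewrite mod0p pint0.
rewrite -pintD -modpD; congr (pint a b (_ %% _)); congr (_ + _).
by rewrite !mxE; ring.
Qed.

End OneInterval.
End VectorPolynomials.

(** * The scheme on one mesh interval *)

Section Step.
Context {R : realType} {d : nat}.
Variables (M A : 'M[R]_d) (t : nat -> R).
Implicit Types (V g : R -> 'cV[R]_d) (phi : {poly R}).

(** The conditions of [solves_VTD] on the [n]-th interval, isolated because the
    jump-based correction is treated interval by interval. *)
Definition vtd_conditions (Q : R -> R -> (R -> R) -> R) (s m : nat) g V n : Prop :=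
  [/\ (1 <= m)%N -> vdright V 0 (t n) = left_value t V n,
      forall i, (i < m./2)%N ->
        M *m vdleft V i.+1 (t n.+1) =
        vdleft g i (t n.+1) - A *m vdleft V i (t n.+1),
      forall i, (i < m.-1./2)%N ->
        M *m vdright V i.+1 (t n) = vdright g i (t n) - A *m vdright V i (t n)
    & forall p : 'cV[{poly R}]_d, vpoly_deg (s - m) p ->
        Q (t n) (t n.+1) (fun x => dot (M *m vderive V x) (vhorner p x))
        + (m == 0%N)%:R * dot (M *m jump t V n) (vhorner p (t n))
        = Q (t n) (t n.+1) (fun x => dot (g x - A *m V x) (vhorner p x))].

Variables (r k n : nat) (f g U Ut : R -> 'cV[R]_d) (p F : 'cV[{poly R}]_d).
Variables (th : {poly R}) (c : 'cV[R]_d).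
Local Notation a := (t n).
Local Notation b := (t n.+1).
Hypotheses (ab : a < b) (hM : M \in unitmx) (hkr : (k < r)%N).
Hypotheses (size_p : vpoly_deg r p) (size_F : vpoly_deg r.+1 F).
Hypothesis Up : forall x, x \in `]a, b] -> U x = vhorner p x.
Hypothesis gF : forall x, x \in `]a, b] -> g x = vhorner F x.
Hypothesis fF :
  forall i, contact_nodes a b r.+1 k.+2 (fun x => f x i 0) (F i 0).
Hypotheses (size_th : (size th <= r.+2)%N) (nodal_th : nodal a b r k %| th).
Hypothesis UtU : forall x, x \in `]a, b] -> Ut x = U x + th.[x] *: c.
Hypothesis left_Ut : left_value t Ut n = left_value t U n.
Hypothesis hU : vtd_conditions (quad r k) r k g U n.

Definition postprocessed : 'cV[{poly R}]_d := \col_i (p i 0 + c i 0 *: th).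
Local Notation pt := postprocessed.
Local Notation rho := (vresid M A p F).

Let kr : (k <= r)%N := ltnW hkr.

Lemma postprocessedE x : x \in `]a, b] -> Ut x = vhorner pt x.
Proof.
move=> xI; rewrite UtU // Up //; apply/colP => i.
by rewrite !mxE hornerD hornerZ mulrC.
Qed.

Lemma vder_postprocessed j x : vder pt j x = vder p j x + (th^`(j)).[x] *: c.
Proof. by apply/colP => i; rewrite !mxE derivnD derivnZ hornerD hornerZ mulrC. Qed.

Lemma vresid_postprocessed i : vresid M A pt F i 0 =
  corrected (rho i 0) th ((M *m c) i 0) ((A *m c) i 0).
Proof.
rewrite /corrected !mxE.
have -> : \sum_j M i j *: (pt j 0)^`() =
    \sum_j M i j *: (p j 0)^`() + (\sum_j M i j * c j 0) *: th^`().
  rewrite scaler_suml -big_split; apply: eq_bigr => j _ /=.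
  by rewrite mxE derivD derivZ scalerDr scalerA.
have -> : \sum_j A i j *: pt j 0 =
    \sum_j A i j *: p j 0 + (\sum_j A i j * c j 0) *: th.
  rewrite scaler_suml -big_split; apply: eq_bigr => j _ /=.
  by rewrite mxE scalerDr scalerA.
ring.
Qed.

Lemma size_rho i : (size (rho i 0%R) <= r.+2)%N.
Proof. by apply: size_vresid => // j; exact: leqW. Qed.

(** The test function has [phi] as its only nonzero component. *)
Lemma rho_test i phi : (size phi <= (r - k).+1)%N ->
  pint a b ((rho i 0 * phi) %% nodal a b r k) +
    (k == 0%N)%:R * ((M *m jump t U n) i 0 * phi.[a]) = 0.
Proof.
move=> sphi; have [_ _ _ /(_ (\col_j (if j == i then phi else 0)))] := hU.
set v := \col_j _ => /(_ _) hv.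
have sv : vpoly_deg (r - k) v.
  by move=> j; rewrite mxE; case: ifP => // _; rewrite size_poly0.
have gFn l : contact_nodes a b r k (fun x => g x l 0) (F l 0).
  apply: contact_nodes_poly => // x; rewrite in_itv /= => /andP[ax xb].
  by rewrite gF ?mxE // in_itv /= ax ltW.
have /eqP := hv sv; rewrite -subr_eq0 addrAC (quad_vresid ab Up _ _ _ kr gFn) => /eqP.
rewrite /dot (bigD1 i) //= [X in _ + X + _]big1 ?addr0; last first.
  by move=> j /negPf ji; rewrite [v j 0]mxE ji mulr0 mod0p pint0.
rewrite (bigD1 i) //= [X in _ + _ * (_ + X)]big1 ?addr0; last first.
  by move=> j /negPf ji; rewrite [vhorner _ _ j 0]mxE [v j 0]mxE ji horner0 mulr0.
by rewrite [vhorner _ _ i 0]mxE [v i 0]mxE eqxx.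
Qed.

Lemma vder_colP (q : 'cV[{poly R}]_d) j x :
  vder q j x = 0 <-> forall i, ((q i 0)^`(j)).[x] = 0.
Proof.
split=> [E i|E]; first by have := congr1 (fun v : 'cV[R]_d => v i 0) E; rewrite !mxE.
by apply/colP => i; rewrite !mxE.
Qed.

Lemma rho_a i : ('X - a%:P) ^+ (uphalf k).-1 %| rho i 0.
Proof.
apply/dvdp_XsubC_expP => j jk; move: i; apply/vder_colP.
have [_ _ /(_ j) h _] := hU; rewrite vder_vresid.
rewrite -!(vdright_poly ab Up) -(vdright_poly ab gF) h; last by case: (k) jk.
by rewrite subrK subrr.
Qed.

Lemma rho_b i : ('X - b%:P) ^+ k./2 %| rho i 0.
Proof.
apply/dvdp_XsubC_expP => j jk; move: i; apply/vder_colP.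
have [_ /(_ j jk) h _ _] := hU; rewrite vder_vresid.
by rewrite -!(vdleft_poly ab Up) -(vdleft_poly ab gF) h subrK subrr.
Qed.

Lemma vdright_f j : (j <= uphalf k)%N -> vdright f j a = vder F j a.
Proof.
move=> jk; apply/colP => i; rewrite !mxE; have [h _ _] := fF i.
exact: (contact_right_dright h).
Qed.

Lemma vdleft_f j : (j <= k./2.+1)%N -> vdleft f j b = vder F j b.
Proof.
move=> jk; apply/colP => i; rewrite !mxE; have [_ h _] := fF i.
exact: (contact_left_dleft h).
Qed.

Lemma th_end_a : (0 < k)%N -> th.[a] = 0.
Proof. by move=> k0; rewrite -[th]derivn0 (th_a ab nodal_th) //; case: (k) k0. Qed.

(** The alternative in the hypothesis is what the two corrections enforce: the
    missing order of the corrected residual at the right end, or the one at the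
    left end, replaced for [k = 0] by continuity. Each implies the other by
    [corrected_a_of_b], [jump_of_b] and [corrected_b_of_a]; the variational
    equation then follows from exactness and [pint_corrected]. *)
Lemma vtd_step :
  vder (vresid M A pt F) k./2 b = 0 \/
  (k = 0%N -> vdright Ut 0 a = left_value t Ut n) /\
  ((0 < k)%N -> vder (vresid M A pt F) (uphalf k).-1 a = 0) ->
  vtd_conditions (quad r.+1 k.+2) r.+1 k.+2 f Ut n.
Proof.
pose rt i := corrected (rho i 0) th ((M *m c) i 0) ((A *m c) i 0).
pose Jt i := (M *m jump t U n) i 0 + (M *m c) i 0 * th.[a].
have rtE i : vresid M A pt F i 0 = rt i by exact: vresid_postprocessed.
have jumpE : vdright Ut 0 a - left_value t Ut n = jump t U n + th.[a] *: c.
  rewrite (vdright_poly ab postprocessedE) vder_postprocessed derivn0.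
  by rewrite -(vdright_poly ab Up) left_Ut addrAC.
have JtE i : Jt i = (M *m (vdright Ut 0 a - left_value t Ut n)) i 0.
  rewrite jumpE mulmxDr -scalemxAr /Jt; move: (M *m jump t U n) (M *m c) => v w.
  by rewrite !mxE mulrC.
(* one order is missing at each end *)
have ca i : ('X - a%:P) ^+ (uphalf k).-1 %| rt i.
  exact: (corrected_a ab _ _ (rho_a i) nodal_th).
have cb i : ('X - b%:P) ^+ k./2 %| rt i.
  exact: (corrected_b ab _ _ (rho_b i) nodal_th).
have a_of_b : (forall i, ('X - b%:P) ^+ k./2.+1 %| rt i) ->
  forall i, ('X - a%:P) ^+ uphalf k %| rt i.
  move=> h i; have [k0|k0] := posnP k; first by rewrite k0 expr0 dvd1p.
  exact: (corrected_a_of_b ab hkr (rho_test i) (rho_a i) size_th nodal_th k0 (h i)).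
move=> hend.
have [ha hb hJ] :
  [/\ forall i, ('X - a%:P) ^+ uphalf k %| rt i,
      forall i, ('X - b%:P) ^+ k./2.+1 %| rt i
    & k = 0%N -> forall i, Jt i = 0].
  case: hend => [hb|[h0 ha]].
    have hb' i : ('X - b%:P) ^+ k./2.+1 %| rt i.
      apply/dvdp_XsubC_expP => j; rewrite ltnS leq_eqVlt => /predU1P[->|jk].
        by have /vder_colP/(_ i) := hb; rewrite rtE.
      by have /dvdp_XsubC_expP := cb i; apply.
    split=> // [|k0 i]; first exact: a_of_b.
    exact: (jump_of_b ab hkr (rho_test i) size_th nodal_th k0 (hb' i)).
  have ha' i : ('X - a%:P) ^+ uphalf k %| rt i.
    have [k0|k0] := posnP k; first by rewrite k0 expr0 dvd1p.
    have q0 : (0 < uphalf k)%N by case: (k) k0.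
    apply/dvdp_XsubC_expP => j; rewrite -(prednK q0) ltnS leq_eqVlt => /predU1P[->|jk].
      by have /vder_colP/(_ i) := ha k0; rewrite rtE.
    by have /dvdp_XsubC_expP := ca i; apply.
  have hJ i : k = 0%N -> Jt i = 0 by move=> /h0 E; rewrite JtE E subrr mulmx0 mxE.
  split=> // [i|k0 i]; last exact: hJ.
  exact: (corrected_b_of_a ab hkr (rho_test i) (rho_b i) size_th nodal_th (hJ i) (ha' i)).
split.
- move=> _; have [k0|k0] := posnP k; last first.
    rewrite left_Ut (vdright_poly ab postprocessedE) vder_postprocessed derivn0.
    rewrite th_end_a // scale0r addr0 -(vdright_poly ab Up).
    by have [->] := hU.
  apply/eqP; rewrite -subr_eq0 -(mulKmx hM (_ - _)).
  rewrite (_ : M *m _ = 0) ?mulmx0 //.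
  by apply/colP => i; rewrite -JtE hJ // mxE.
- move=> i ik; rewrite !(vdleft_poly ab postprocessedE) vdleft_f; last exact: ltnW.
  apply/eqP; rewrite -subr_eq0 opprB addrA -vder_vresid; apply/eqP/vder_colP => l.
  by rewrite rtE; have /dvdp_XsubC_expP := hb l; apply.
- move=> i ik; have {}ik : (i < uphalf k)%N by [].
  rewrite !(vdright_poly ab postprocessedE) vdright_f; last exact: ltnW.
  apply/eqP; rewrite -subr_eq0 opprB addrA -vder_vresid; apply/eqP/vder_colP => l.
  by rewrite rtE; have /dvdp_XsubC_expP := ha l; apply.
- move=> phi sphi; rewrite mul0r addr0; apply/eqP; rewrite -subr_eq0.
  have kr' : (k.+2 <= r.+1)%N by [].
  rewrite (quad_vresid ab postprocessedE _ _ _ kr' fF); apply/eqP.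
  rewrite big1 // => i _.
  have sphi' : (size (phi i 0%R) <= r - k)%N.
    by rewrite (leq_trans (sphi i)) // subSS -subSn // subSS.
  rewrite rtE (quad_exact ab kr'); last first.
    have srt : (size (rt i) <= r.+2)%N by apply: size_corrected => //; exact: size_rho.
    by have := size_polyM_le srt (sphi i); rewrite addnS.
  rewrite (pint_corrected ab hkr _ _ (size_rho i) (rho_test i)) // -/(Jt i).
  by case: eqVneq => [/hJ->|_]; rewrite !mul0r ?mulr0 oppr0.
Qed.

End Step.

(** * The scheme on the mesh *)

Section Mesh.
Context {R : realType} {d : nat}.
Variables (t : nat -> R) (N : nat).
Hypothesis hmesh : forall n, (n < N)%N -> t n < t n.+1.
Implicit Types (f V : R -> 'cV[R]_d) (F : 'cV[{poly R}]_d).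

Lemma mesh_le i j : (i <= j)%N -> (j <= N)%N -> t i <= t j.
Proof.
elim: j => [|j IH]; first by rewrite leqn0 => /eqP->.
rewrite leq_eqVlt => /predU1P[->//|]; rewrite ltnS => ij jN.
by rewrite (le_trans (IH ij (ltnW jN))) // ltW // hmesh.
Qed.

(** The mesh intervals are disjoint. *)
Lemma mesh_itvP n i x : (n < N)%N -> (i < N)%N -> x \in `]t n, t n.+1] ->
  (t i < x <= t i.+1) = (i == n).
Proof.
move=> nN iN; rewrite in_itv /= => /andP[nx xn].
have [ni|ni|->] := ssrnat.ltngtP i n; last by rewrite nx xn.
- apply/negbTE; rewrite negb_and orbC -ltNge (le_lt_trans _ nx) //.
  by rewrite mesh_le // ltnW.
- have xi : x <= t i by rewrite (le_trans xn) // mesh_le // ltnW.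
  by rewrite ltNge xi.
Qed.

Lemma mesh_interp_poly s m f F n x : (m <= s)%N -> (n < N)%N -> vpoly_deg s F ->
  (forall i, contact_nodes (t n) (t n.+1) s m (fun y => f y i 0) (F i 0)) ->
  x \in `]t n, t n.+1] -> mesh_interp s m t N f x = vhorner F x.
Proof.
move=> ms nN sF fF xI; rewrite /mesh_interp (big_pred1 (Ordinal nN)); last first.
  by move=> i; rewrite (mesh_itvP nN _ xI).
apply/colP => i; rewrite !mxE (interp_contact (hmesh nN) x ms (fF i)) modp_small //.
by rewrite size_nodal ?hmesh // ltnS.
Qed.

Lemma vdleft_vdright K lo hi f j x : vsmooth_on K lo hi f -> (j <= K)%N ->
  x \in `]lo, hi[ -> vdleft f j x = vdright f j x.
Proof.
move=> hf jK xI; apply/colP => i; rewrite !mxE /dleft /dright.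
have [_ _ /(_ j x jK xI) cf _] := hf i.
rewrite (cvg_lim _ (cvg_at_left_filter cf)) //.
by rewrite (cvg_lim _ (cvg_at_right_filter cf)).
Qed.

Variables (M A : 'M[R]_d) (u0 : 'cV[R]_d) (r k : nat).
Variables (f U Ut : R -> 'cV[R]_d) (th : nat -> {poly R}) (c : nat -> 'cV[R]_d).
Hypotheses (hM : M \in unitmx) (hkr : (k < r)%N).
Hypothesis hf : vsmooth_on k./2.+1 (t 0) (t N) f.
Hypothesis hU : solves_VTD M A u0 t N (quad r k) r k (mesh_interp r.+1 k.+2 t N f) U.
Hypothesis Ut0 : left_value t Ut 0 = left_value t U 0.
Hypothesis size_th : forall n, (n < N)%N -> (size (th n) <= r.+2)%N.
Hypothesis nodal_th : forall n, (n < N)%N -> nodal (t n) (t n.+1) r k %| th n.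
Hypothesis UtU : forall n, (n < N)%N -> forall x, x \in `]t n, t n.+1] ->
  Ut x = U x + (th n).[x] *: c n.

Lemma local_polynomials n : (n < N)%N -> exists p F : 'cV[{poly R}]_d,
  [/\ vpoly_deg r p, forall x, x \in `]t n, t n.+1] -> U x = vhorner p x,
      vpoly_deg r.+1 F,
      forall x, x \in `]t n, t n.+1] -> mesh_interp r.+1 k.+2 t N f x = vhorner F x
    & forall i, contact_nodes (t n) (t n.+1) r.+1 k.+2 (fun x => f x i 0) (F i 0)].
Proof.
move=> nN; have [UY _ _] := hU; have [p sp Up] := UY n nN.
have hF i : exists G : {poly R}, (size G <= r.+2)%N /\
    contact_nodes (t n) (t n.+1) r.+1 k.+2 (fun x => f x i 0) G.
  have [||||G sG hG] := contact_nodes_exists (hmesh nN) (s := r.+1) (m := k.+2) _ _ _ _ (hf i).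
  - by [].
  - by [].
  - by rewrite mesh_le // ltnW.
  - exact: mesh_le.
  - by exists G.
have [F hF'] := choice hF.
have sF : vpoly_deg r.+1 (\col_i F i) by move=> i; rewrite mxE; case: (hF' i).
have fF i : contact_nodes (t n) (t n.+1) r.+1 k.+2 (fun x => f x i 0) ((\col_i F i) i 0).
  by rewrite mxE; case: (hF' i).
exists p, (\col_i F i); split=> // x; exact: mesh_interp_poly.
Qed.

(** The correction vanishes at the right end of every interval. *)
Lemma left_value_post n : (n <= N)%N -> left_value t Ut n = left_value t U n.
Proof.
case: n => [//|n] nN; have [p [F [_ Up _ _ _]]] := local_polynomials nN.
have ab := hmesh nN.
rewrite /= (vdleft_poly ab Up) (vdleft_poly ab (postprocessedE Up (UtU nN))).
rewrite vder_postprocessed (th_b ab (nodal_th nN)) // scale0r addr0 //.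
Qed.

Lemma in_Y_post : in_Y t N r.+1 Ut.
Proof.
move=> n nN; have [p [F [sp Up _ _ _]]] := local_polynomials nN.
exists (postprocessed p (th n) (c n)); last exact: postprocessedE Up (UtU nN).
move=> i; rewrite mxE (leq_trans (size_polyD _ _)) // geq_max leqW //=.
by rewrite (leq_trans (size_scale_leq _ _)) // size_th.
Qed.

(** The coefficient [coef_res] is chosen so that the corrected residual loses its
    derivative of order [k./2] at the right end. *)
Lemma vtd_residual_step n : (n < N)%N -> ((th n)^`(k./2.+1)).[t n.+1] = 1 ->
  c n = coef_res M A t k f U n ->
  vtd_conditions M A t (quad r.+1 k.+2) r.+1 k.+2 f Ut n.
Proof.
move=> nN th1 cn; have [p [F [sp Up sF gF fF]]] := local_polynomials nN.
have [_ _ /(_ n nN) hUn] := hU.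
have ab := hmesh nN.
apply: (vtd_step ab hM hkr sp sF Up gF fF (size_th nN) (nodal_th nN) (UtU nN)
  (left_value_post (ltnW nN)) hUn); left.
rewrite vder_vresid !vder_postprocessed th1 (th_b ab (nodal_th nN)) //.
rewrite scale0r addr0 scale1r mulmxDr cn /coef_res mulKVmx //.
rewrite !(vdleft_poly ab Up) (vdleft_f fF) //.
by apply/colP => i; rewrite !mxE; ring.
Qed.

(** The derivatives that the jump-based correction matches at [t n]: the initial
    ones defined recursively from [u0], or those of the corrected solution on
    the preceding interval. *)
Definition incoming (n j : nat) : 'cV[R]_d :=
  if n is 0 then u_init M A u0 t f j else vdleft Ut j (t n).

(** For [n > 0] these are the conditions at the right end of the preceding
    interval, since the derivatives of [f] do not jump at [t n]. *)
Lemma incoming_ode n j : (n < N)%N -> (j <= k./2)%N ->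
  ((0 < n)%N -> vtd_conditions M A t (quad r.+1 k.+2) r.+1 k.+2 f Ut n.-1) ->
  M *m incoming n j.+1 = vdright f j (t n) - A *m incoming n j.
Proof.
case: n => [|n] nN jk; first by move=> _; rewrite /= mulKVmx.
move=> /(_ isT)[_ h _ _]; rewrite [LHS]h //; congr (_ - _).
apply: (vdleft_vdright hf); first exact: leqW.
rewrite in_itv /= (lt_le_trans (hmesh nN)) ?mesh_le // andbT.
by rewrite (le_lt_trans _ (hmesh (ltnW nN))) // mesh_le // ltnW // ltnW.
Qed.

(** By construction the corrected solution takes over the incoming derivative of
    order [uphalf k]. The lower orders agree with the incoming ones because
    both obey the same recursion and start from the same value. Hence the
    equation satisfied by the incoming derivatives is inherited. *)
Lemma vtd_jump_step n : (n < N)%N -> ((th n)^`(uphalf k)).[t n] = 1 ->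
  c n = - coef_jump M A u0 t k f U Ut n ->
  ((0 < n)%N -> vtd_conditions M A t (quad r.+1 k.+2) r.+1 k.+2 f Ut n.-1) ->
  vtd_conditions M A t (quad r.+1 k.+2) r.+1 k.+2 f Ut n.
Proof.
move=> nN th1 cn prev; have [p [F [sp Up sF gF fF]]] := local_polynomials nN.
have [_ Uu0 /(_ n nN) hUn] := hU.
have ab := hmesh nN.
pose pt := postprocessed p (th n) (c n).
have ptq : vder pt (uphalf k) (t n) = incoming n (uphalf k).
  rewrite vder_postprocessed th1 scale1r cn /coef_jump (vdright_poly ab Up).
  by rewrite opprB addrCA subrr addr0.
have in0 : left_value t Ut n = incoming n 0.
  by case: (n) => [|//]; rewrite Ut0 Uu0.
have ptj j : (j <= uphalf k)%N -> vder pt j (t n) = incoming n j.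
  move=> jk; have [->//|] := eqVneq j (uphalf k).
  move: jk; rewrite leq_eqVlt => /predU1P[->|]; first by rewrite eqxx.
  move=> + _; elim: j => [|j IH] jq.
    rewrite vder_postprocessed (th_a ab (nodal_th nN)) // scale0r addr0.
    rewrite -(vdright_poly ab Up 0) -in0 (left_value_post (ltnW nN)).
    by have [h _ _ _] := hUn; apply: h; case: (k) jq.
  apply: (can_inj (mulKmx hM)).
  have jk : (j <= k./2)%N by move: jq; rewrite uphalf_half; case: (odd k); lia.
  have jq' : (j < (uphalf k).-1)%N by move: jq; case: uphalf.
  rewrite incoming_ode // -IH; last exact: ltnW.
  rewrite !vder_postprocessed !(th_a ab (nodal_th nN)) ?(ltnW jq) //.
  rewrite !scale0r !addr0 -!(vdright_poly ab Up).
  have [_ _ h _] := hUn; rewrite h; last by move: jq'; case: (k).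
  by rewrite (vdright_poly ab gF) (vdright_f fF) // ltnW // ltnW.
apply: (vtd_step ab hM hkr sp sF Up gF fF (size_th nN) (nodal_th nN) (UtU nN)
  (left_value_post (ltnW nN)) hUn); right.
split=> [k0|k0].
  rewrite in0 (vdright_poly ab (postprocessedE Up (UtU nN))).
  exact: ptj.
have q0 : (0 < uphalf k)%N by case: (k) k0.
rewrite vder_vresid prednK // !ptj ?leq_pred // -{1}(prednK q0) incoming_ode //; last first.
  rewrite -ltnS prednK // uphalf_half; case: (odd k); lia.
by rewrite (vdright_f fF) ?leq_pred // subrK subrr.
Qed.

End Mesh.

(** * Both corrections *)

Unset Implicit Arguments.

Theorem theorem5p1 (R : realType) (d : nat) (M A : 'M[R]_d) (u0 : 'cV[R]_d)
  (f : R -> 'cV[R]_d) (t0 T : R) (N : nat) (t : nat -> R) (r k : nat)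
  (U Ut : R -> 'cV[R]_d)
  (hT : 0 < T) (ht0 : t 0%N = t0) (htN : t N = t0 + T)
  (hmesh : forall n, (n < N)%N -> t n < t n.+1)
  (hM : M \in unitmx)
  (hf : vsmooth_on k./2.+1 t0 (t0 + T) f)
  (hkr : (k < r)%N)
  (hU : solves_VTD M A u0 t N (quad r k) r k
          (mesh_interp r.+1 k.+2 t N f) U)
  (hUt : residual_post M A t N r k f U Ut \/ jump_post M A u0 t N r k f U Ut) :
  solves_VTD M A u0 t N (quad r.+1 k.+2) r.+1 k.+2 f Ut.
Proof.
rewrite -htN -ht0 in hf.
have kr : (k <= r)%N := ltnW hkr.
have [_ Uu0 _] := hU.
case: hUt => -[Ut0 UtE].
- pose th n := theta_res r k (t n) (t n.+1).
  have thP n : (n < N)%N -> is_theta_res r k (t n) (t n.+1) (th n).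
    by move=> nN; apply: theta_resP => //; exact: hmesh.
  have size_th n : (n < N)%N -> (size (th n) <= r.+2)%N by case/thP.
  have nodal_th n : (n < N)%N -> nodal (t n) (t n.+1) r k %| th n.
    by move=> nN; have [_ /(vanishes_nodal (hmesh n nN))] := thP n nN.
  split; [|by rewrite Ut0|].
    exact: (in_Y_post hmesh hkr hf hU size_th UtE).
  move=> n nN; have [_ _ th1] := thP n nN.
  exact: (vtd_residual_step hmesh hM hkr hf hU Ut0 size_th nodal_th UtE nN th1).
- pose th n := theta_jump r k (t n) (t n.+1).
  have thP n : (n < N)%N -> is_theta_jump r k (t n) (t n.+1) (th n).
    by move=> nN; apply: theta_jumpP => //; exact: hmesh.
  have size_th n : (n < N)%N -> (size (th n) <= r.+2)%N by case/thP.
  have nodal_th n : (n < N)%N -> nodal (t n) (t n.+1) r k %| th n.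
    by move=> nN; have [_ /(vanishes_nodal (hmesh n nN))] := thP n nN.
  have UtE' n : (n < N)%N -> forall x, x \in `]t n, t n.+1] ->
      Ut x = U x + (th n).[x] *: (- coef_jump M A u0 t k f U Ut n).
    by move=> nN x xI; rewrite scalerN; exact: UtE.
  split; [|by rewrite Ut0|].
    exact: (in_Y_post hmesh hkr hf hU size_th UtE').
  elim=> [|n IH] nN; have [_ _ th1] := thP _ nN;
    apply: (vtd_jump_step hmesh hM hkr hf hU Ut0 size_th nodal_th UtE' nN th1) => // _.
  by apply: IH; exact: ltnW.
Qed.
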